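(* Let $X,Y$ be uncountable Polish spaces, and let $\mathbf{\Gamma}$ be a class of subsets of Polish spaces which is closed under continuous preimages, finite unions and finite intersections, and satisfies $\mathbf{\Pi}^0_1\cup\mathbf{\Sigma}^0_1\subset\mathbf{\Gamma}$. Suppose that $\Phi:\mathbf{\Gamma}(X)\to\mathbf{\Pi}^1_1(Y)$ is $\mathbf{\Pi}^1_1$ on $\mathbf{\Gamma}$ and that the family $\mathcal{F}^{\Phi}$ is nicely $\mathbf{\Sigma}^1_1$-hard on $\mathbf{\Gamma}$. Then the family $\mathcal{U}^{\Phi}$ is $\mathbf{\Sigma}^1_2$-hard on $\mathbf{\Gamma}$; that is, there is a set $B\in\mathbf{\Gamma}(\mathbb{N}^{\mathbb{N}}\times\mathbb{N}^{\mathbb{N}}\times X)$ such that $\{s\in\mathbb{N}^{\mathbb{N}}:B_s\in\mathcal{U}^{\Phi}\}$ is $\mathbf{\Sigma}^1_2$-hard.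
   Context: For a class $\mathbf{\Gamma}$ of subsets of Polish spaces, $\mathbf{\Gamma}(X)$ denotes the collection of subsets of $X$ belonging to $\mathbf{\Gamma}$. For $B\subset Z\times W$ and $s\in Z$, $B_s=\{w\in W:(s,w)\in B\}$. A map $\Phi:\mathbf{\Gamma}(X)\to\mathbf{\Pi}^1_1(Y)$ is $\mathbf{\Pi}^1_1$ on $\mathbf{\Gamma}$ if for every Polish space $P$ and every $A\in\mathbf{\Gamma}(P\times X)$ we have $\{(s,y)\in P\times Y:y\in\Phi(A_s)\}\in\mathbf{\Pi}^1_1(P\times Y)$. The family $\mathcal{F}^{\Phi}\subset\mathbf{\Gamma}(X)$ is defined by $A\in\mathcal{F}^{\Phi}\iff\Phi(A)\ne\emptyset$. For $B\in\mathbf{\Gamma}(\mathbb{N}^{\mathbb{N}}\times X)$ let $\bar\Phi(B)=\{(s,y)\in\mathbb{N}^{\mathbb{N}}\times Y:y\in\Phi(B_s)\}$. The uniform family $\mathcal{U}^{\Phi}\subset\mathbf{\Gamma}(\mathbb{N}^{\mathbb{N}}\times X)$ is defined by: $B\in\mathcal{U}^{\Phi}$ iff $\bar\Phi(B)$ has a full Borel uniformization, i.e. $\bar\Phi(B)$ contains the graph of a Borel function $\mathbb{N}^{\mathbb{N}}\to Y$. The family $\mathcal{F}^{\Phi}$ is nicely $\mathbf{\Sigma}^1_1$-hard on $\mathbf{\Gamma}$ if for every $A\in\mathbf{\Sigma}^1_1(\mathbb{N}^{\mathbb{N}})$ there exist $B\in\mathbf{\Gamma}(\mathbb{N}^{\mathbb{N}}\times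 X)$ and $D\in\mathbf{\Sigma}^1_1(\mathbb{N}^{\mathbb{N}}\times Y)$ such that $D\subset\bar\Phi(B)$ and for all $s\in\mathbb{N}^{\mathbb{N}}$: $s\in A\iff D_s\neq\emptyset\iff\Phi(B_s)\neq\emptyset$. A family $\mathcal{F}$ of subsets of a Polish space $Z$ is $\mathbf{\Sigma}^1_2$-hard on $\mathbf{\Gamma}$ if there is $B\in\mathbf{\Gamma}(\mathbb{N}^{\mathbb{N}}\times Z)$ such that $\{s\in\mathbb{N}^{\mathbb{N}}:B_s\in\mathcal{F}\}$ is $\mathbf{\Sigma}^1_2$-hard. A subset $A$ of a Polish space $Z$ is $\mathbf{\Sigma}^1_2$-hard if for every Polish space $Z'$ and every $\mathbf{\Sigma}^1_2$ set $A'\subset Z'$ there is a Borel map $f:Z'\to Z$ with $z'\in A'\iff f(z')\in A$ for all $z'\in Z'$. *)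

(* Defs.v *)
From HB Require Import structures.
From mathcomp Require Import all_boot all_order all_algebra.
From mathcomp Require Import all_classical all_reals all_analysis.

Set Implicit Arguments.
Unset Strict Implicit.
Unset Printing Implicit Defensive.

Import Order.TTheory GRing.Theory Num.Theory.

Local Open Scope classical_set_scope.
Local Open Scope ring_scope.

Definition is_metric (R : realType) (T : Type) (d : T -> T -> R) : Prop :=
  [/\ forall x y, d x y = 0 <-> x = y,
      forall x y, d x y = d y x
    & forall x y z, d x z <= d x y + d y z].

Definition metric_cauchy (R : realType) (T : Type) (d : T -> T -> R)
    (u : nat -> T) : Prop :=
  forall e : R, 0 < e ->
    exists N : nat, forall m n : nat, (N <= m)%N -> (N <= n)%N -> d (u m) (u n) < e.

(* The metric is only required to exist: a Polish space carries no chosen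
   metric. The empty space is Polish. *)
Definition completely_metrizable (R : realType) (T : topologicalType) : Prop :=
  exists d : T -> T -> R,
    [/\ is_metric d,
        forall (x : T) (A : set T),
          nbhs x A <-> exists2 e : R, 0 < e & [set y | d x y < e] `<=` A
      & forall u : nat -> T, metric_cauchy d u -> exists l : T, u @ \oo --> l].

Definition separable (T : topologicalType) : Prop :=
  exists2 S : set T, countable S & dense S.

Definition polish (R : realType) (T : topologicalType) : Prop :=
  separable T /\ completely_metrizable R T.

Definition baire : Type := prod_topology (fun _ : nat => nat).

HB.instance Definition _ := Pointed.on baire.
HB.instance Definition _ := Nbhs.on baire.
HB.instance Definition _ := Topological.on baire.

Definition borel_set (T : topologicalType) : set (set T) := <<s @open T >>.

Definition borel_function (T U : topologicalType) (f : T -> U) : Prop :=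
  forall B : set U, borel_set B -> borel_set (f @^-1` B).

(* The boldface projective classes, obtained from the closed sets by
   alternating projection along the Baire space and complementation. *)
Definition Sigma11 (T : topologicalType) : set (set T) :=
  [set A | exists2 C : set (T * baire), closed C & A = fst @` C].

Definition Pi11 (T : topologicalType) : set (set T) :=
  [set A | Sigma11 (~` A)].

Definition Sigma12 (T : topologicalType) : set (set T) :=
  [set A | exists2 C : set (T * baire), Pi11 C & A = fst @` C].

(* A class of subsets of Polish spaces; its values at spaces that are not
   Polish are irrelevant, and no condition below constrains them. *)
Definition set_class : Type := forall T : topologicalType, set (set T).

Definition closed_under_continuous_preimages (R : realType)
    (Gamma : set_class) : Prop :=
  forall (T U : topologicalType), polish R T -> polish R U ->
    forall (f : T -> U) (A : set U),
      continuous f -> Gamma U A -> Gamma T (f @^-1` A).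

Definition closed_under_unions (R : realType) (Gamma : set_class) : Prop :=
  forall T : topologicalType, polish R T ->
    forall A B : set T, Gamma T A -> Gamma T B -> Gamma T (A `|` B).

Definition closed_under_intersections (R : realType) (Gamma : set_class) : Prop :=
  forall T : topologicalType, polish R T ->
    forall A B : set T, Gamma T A -> Gamma T B -> Gamma T (A `&` B).

Definition contains_closed_and_open (R : realType) (Gamma : set_class) : Prop :=
  forall T : topologicalType, polish R T ->
    forall A : set T, closed A \/ open A -> Gamma T A.

(* A map Gamma(X) -> Pi11(Y) is represented by a total Phi : set X -> set Y
   mapping Gamma X into Pi11 Y; the values of Phi outside Gamma X are never
   used. *)
Definition maps_to_Pi11 (X Y : topologicalType) (Gamma : set_class)
    (Phi : set X -> set Y) : Prop :=
  forall A : set X, Gamma X A -> Pi11 (Phi A).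

Definition section_graph (P X Y : topologicalType) (Phi : set X -> set Y)
    (A : set (P * X)) : set (P * Y) :=
  [set p | Phi (xsection A p.1) p.2].

Definition Pi11_on (R : realType) (X Y : topologicalType) (Gamma : set_class)
    (Phi : set X -> set Y) : Prop :=
  forall P : topologicalType, polish R P ->
    forall A : set (P * X), Gamma (P * X)%type A -> Pi11 (section_graph Phi A).

Definition bar (X Y : topologicalType) (Phi : set X -> set Y)
    (B : set (baire * X)) : set (baire * Y) :=
  section_graph Phi B.

Definition full_borel_uniformization (Y : topologicalType)
    (D : set (baire * Y)) : Prop :=
  exists2 f : baire -> Y, borel_function f & forall s, D (s, f s).

Definition nonempty_family (X Y : topologicalType) (Gamma : set_class)
    (Phi : set X -> set Y) : set (set X) :=
  [set A | Gamma X A /\ Phi A !=set0].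

Definition uniform_family (X Y : topologicalType) (Gamma : set_class)
    (Phi : set X -> set Y) : set (set (baire * X)) :=
  [set B | Gamma (baire * X)%type B /\ full_borel_uniformization (bar Phi B)].

(* "The family F^Phi (= nonempty_family Gamma Phi) is nicely Sigma11-hard on
   Gamma"; the property depends on Phi and not only on the family. As B is in
   Gamma, so are its sections, hence the last condition says that
   xsection B s belongs to that family. *)
Definition nicely_Sigma11_hard_on (X Y : topologicalType) (Gamma : set_class)
    (Phi : set X -> set Y) : Prop :=
  forall A : set baire, Sigma11 A ->
    exists (B : set (baire * X)) (D : set (baire * Y)),
      [/\ Gamma (baire * X)%type B, Sigma11 D, D `<=` bar Phi B
        & forall s : baire,
            (A s <-> xsection D s !=set0) /\
            (xsection D s !=set0 <-> Phi (xsection B s) !=set0)].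

Definition Sigma12_hard (R : realType) (Z : topologicalType) (A : set Z) : Prop :=
  forall Z' : topologicalType, polish R Z' ->
    forall A' : set Z', Sigma12 A' ->
      exists2 f : Z' -> Z, borel_function f & forall z', A' z' <-> A (f z').

Definition Sigma12_hard_on (R : realType) (Z : topologicalType)
    (Gamma : set_class) (F : set (set Z)) : Prop :=
  exists2 B : set (baire * Z), Gamma (baire * Z)%type B
    & Sigma12_hard R [set s : baire | F (xsection B s)].

(* Main.v *)
(* Let U be a universal analytic set and apply the hardness hypothesis to it; this
   gives B0 in Gamma whose z-th section has a nonempty image under Phi iff z is
   in U, and a tree T_z, depending continuously on z, whose branches are
   witnesses of this.
   A Sigma12 set has the form S = {s | some branch of s codes a well-founded
   relation}. Call (P, <) a pseudo-rank for (s, z) if < is a total preorder on a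
   set P of nodes of T_z which looks like the comparison of ranks of the
   well-founded nodes of T_z, and which looks well-founded to the derivatives of
   the trees of attempts to find a branch of s together with a homomorphism of
   the coded relation into a proper initial segment of P.
   - If s is not in S, the true ranks of T_z form a pseudo-rank.
   - If s is in S, a branch x of s bounds the lengths of the well-founded parts of
     all pseudo-ranks. These are therefore Borel sets uniformly in z, and they
     show a branch of T_z to a Borel function if there is one.
   A parameter t = (q, w) consists of a Borel code q and a (closed witness of a)
   pseudo-rank w for (s, z), where z = r(s, q) is chosen by diagonalization: z is
   in U iff q is not well-founded or some such w' makes the Borel function with
   code q miss the set Phi (B0)_z at (q, w'). As soon as there is a pseudo-rank,
   z is in U. If s is not in S, no Borel function selects elements of
   Phi (B0)_(r(s, q)) at all parameters (q, w); if s is in S, some Borel function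
   does. Parameters without a pseudo-rank are sent to a fixed element of U. *)

Require Import Defs.
From mathcomp Require Import all_boot all_order all_algebra.
From mathcomp Require Import all_classical all_reals all_analysis.
From mathcomp Require Import lra.

Set Implicit Arguments.
Unset Strict Implicit.
Unset Printing Implicit Defensive.

Import Order.TTheory GRing.Theory Num.Theory.

(** * Ranks of well-founded relations *)

(** A least fixed point, so [a] must be accessible when it holds, whereas an inaccessible [b] counts
    as having infinite rank. *)
Inductive rk_le (A B : Type) (ra : A -> A -> Prop) (rb : B -> B -> Prop)
    (a : A) (b : B) : Prop :=
  RkLe of (forall a', ra a' a -> exists2 b', rb b' b & rk_le ra rb a' b').

Definition rk_lt (A B : Type) (ra : A -> A -> Prop) (rb : B -> B -> Prop) a b :=
  exists2 b', rb b' b & rk_le ra rb a b'.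

Lemma rk_leP A B (ra : A -> A -> Prop) (rb : B -> B -> Prop) a b :
  rk_le ra rb a b <->
  forall a', ra a' a -> exists2 b', rb b' b & rk_le ra rb a' b'.
Proof. by split=> [[h] //|h]; exact: RkLe h. Qed.

Lemma rk_le_Acc A B (ra : A -> A -> Prop) (rb : B -> B -> Prop) a b :
  Acc rb b -> rk_le ra rb a b -> Acc ra a.
Proof.
move=> accb; elim: accb a => {}b _ ih a [h]; constructor=> a' /h[b' bb' le']; exact: ih bb' _ le'.
Qed.

Lemma rk_le_refl A (ra : A -> A -> Prop) a : Acc ra a -> rk_le ra ra a a.
Proof. by elim=> {}a _ ih; constructor=> a' aa'; exists a' => //; exact: ih. Qed.

Lemma rk_le_trans A B C (ra : A -> A -> Prop) (rb : B -> B -> Prop)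
    (rc : C -> C -> Prop) a b c : Acc ra a ->
  rk_le ra rb a b -> rk_le rb rc b c -> rk_le ra rc a c.
Proof.
move=> acca; elim: acca b c => {}a _ ih b c [ab] [bc].
constructor=> a' aa'; have [b' bb' ab'] := ab _ aa'.
have [c' cc' bc'] := bc _ bb'; exists c' => //; exact: ih bc'.
Qed.

Lemma rk_lt_irr A (ra : A -> A -> Prop) a : Acc ra a -> ~ rk_lt ra ra a a.
Proof. by elim=> {}a _ ih [a' aa' [h]]; apply: (ih _ aa'); exact: h. Qed.

(** If the comparison fails, some [a'] below [a] is dominated by no [b'] below [b]. By induction all
    these [b'] have smaller rank than [a'], so [a'] bounds the rank of [b]. *)
Lemma rk_le_lt_total A B (ra : A -> A -> Prop) (rb : B -> B -> Prop) a b :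
  Acc ra a -> rk_le ra rb a b \/ rk_lt rb ra b a.
Proof.
move=> acca; elim: acca b => {}a _ ih b.
have [|nle] := pselect (rk_le ra rb a b); first by left.
right; move/rk_leP: nle => /existsNP[a' /not_implyP[aa' nb]].
exists a'; first exact: aa'.
constructor=> b' bb'.
have [le'|] := ih _ aa' b'; last exact.
by case: nb; exists b'.
Qed.

Lemma rk_le_lt_trans A B C (ra : A -> A -> Prop) (rb : B -> B -> Prop)
    (rc : C -> C -> Prop) a b c : Acc ra a ->
  rk_le ra rb a b -> rk_lt rb rc b c -> rk_lt ra rc a c.
Proof. by move=> acca ab [c' cc' bc']; exists c' => //; exact: rk_le_trans bc'. Qed.

Lemma rk_lt_le_trans A B C (ra : A -> A -> Prop) (rb : B -> B -> Prop)
    (rc : C -> C -> Prop) a b c : Acc ra a ->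
  rk_lt ra rb a b -> rk_le rb rc b c -> rk_lt ra rc a c.
Proof.
move=> acca [b' bb' ab'] [bc]; have [c' cc' bc'] := bc _ bb'.
by exists c' => //; exact: rk_le_trans bc'.
Qed.

Lemma rk_le_ltF A B (ra : A -> A -> Prop) (rb : B -> B -> Prop) a b :
  Acc ra a -> rk_le ra rb a b -> rk_lt rb ra b a -> False.
Proof. by move=> acca ab ba; apply: (@rk_lt_irr _ ra a) => //; exact: rk_le_lt_trans ba. Qed.

Lemma acc_min A (ra : A -> A -> Prop) (P : A -> Prop) a : Acc ra a -> P a ->
  exists b, [/\ P b, Acc ra b & forall c, ra c b -> ~ P c].
Proof.
elim=> {}a acca ih Pa.
have [[c ca Pc]|nc] := pselect (exists2 c, ra c a & P c); first exact: ih ca Pc.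
exists a; split; [exact: Pa|exact: Acc_intro|].
by move=> c ca Pc; apply: nc; exists c.
Qed.

Lemma not_acc_step A (ra : A -> A -> Prop) a :
  ~ Acc ra a -> exists2 b, ra b a & ~ Acc ra b.
Proof.
apply: contra_notP => h; constructor=> b ba.
by apply: contra_notP h => nb; exists b.
Qed.

Lemma not_acc_path A (ra : A -> A -> Prop) a :
  ~ Acc ra a -> exists2 f : nat -> A, f 0%N = a & forall n, ra (f n.+1) (f n).
Proof.
move=> na.
have /choice[g gP] : forall p : {x | ~ Acc ra x}, exists q : {x | ~ Acc ra x},
    ra (proj1_sig q) (proj1_sig p).
  by move=> [x nx]; have [y yx ny] := not_acc_step nx; exists (exist _ y ny).
exists (fun n => proj1_sig (iter n g (exist _ a na))) => // n.
exact: gP.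
Qed.

Lemma path_not_acc A (ra : A -> A -> Prop) (f : nat -> A) :
  (forall n, ra (f n.+1) (f n)) -> ~ Acc ra (f 0%N).
Proof.
move=> fP acc0.
suff: forall a, Acc ra a -> forall n, f n <> a by move/(_ _ acc0 0%N); exact.
by move=> a; elim=> {}a _ ih n fna; apply: (ih (f n.+1) _ n.+1) => //; rewrite -fna.
Qed.

(** Turns an infinite path through a tree of finite sequences into the branch which it
    approximates. *)
Lemma rcons_path_limit (A : Type) (a0 : A) (g : nat -> seq A) :
  (forall n, exists a, g n.+1 = rcons (g n) a) ->
  (forall n, size (g n) = (size (g 0%N) + n)%N) /\
  exists h : nat -> A, forall n, g n = mkseq h (size (g n)).
Proof.
move=> gP.
have sz n : size (g n) = (size (g 0%N) + n)%N.
  elim: n => [|n ih]; first by rewrite addn0.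
  by have [a ->] := gP n; rewrite size_rcons ih addnS.
split=> //.
have pre n m k : (k < size (g n))%N -> nth a0 (g (n + m)%N) k = nth a0 (g n) k.
  elim: m => [|m ih] kn; first by rewrite addn0.
  rewrite addnS; have [a ->] := gP (n + m)%N.
  rewrite nth_rcons ifT; first exact: ih.
  by apply: leq_trans kn _; rewrite (sz n) (sz (n + m)%N) leq_add2l leq_addr.
(* Entry [k] is read off at stage [k.+1], where the sequence is certain to be longer than [k]. *)
exists (fun k => nth a0 (g k.+1) k) => n.
apply: (@eq_from_nth _ a0) => [|k kn]; first by rewrite size_mkseq.
rewrite nth_mkseq //; have [le|/ltnW le] := leqP n k.+1.
  by rewrite -(subnKC le) pre.
rewrite -(subnKC le) pre // sz; exact: leq_trans (leq_addl _ _).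
Qed.

(** * Pseudo-ranks *)

(** Only parities code the relation; the halves of the values stay free to store a further point of
    the Baire space in the hardness proof. *)
Definition rel_of (x : nat -> nat) (i j : nat) : Prop := odd (x (pickle (i, j))).

Definition has_wf_branch (s : seq nat -> bool) : Prop :=
  exists2 x : nat -> nat, forall n, s (mkseq x n) & well_founded (rel_of x).

(* Finite attempts [(x_0, f_0); (x_1, f_1); ...] at building a branch x of s
   together with a homomorphism f from rel_of x to the restriction of lt to
   dom. *)
Definition attempt (s : seq nat -> bool) (lt : nat -> nat -> Prop)
    (dom : nat -> Prop) (v : seq (nat * nat)) : Prop :=
  [/\ forall k, (k < size v)%N -> s (take k (unzip1 v)),
      forall k, (k < size v)%N -> dom (nth 0 (unzip2 v) k)%N
    & forall i j, (pickle (i, j) < size v)%N -> (i < size v)%N ->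
        (j < size v)%N -> odd (nth 0 (unzip1 v) (pickle (i, j)))%N ->
        lt (nth 0 (unzip2 v) i)%N (nth 0 (unzip2 v) j)%N].

Definition extends (G : seq (nat * nat) -> Prop) (v' v : seq (nat * nat)) : Prop :=
  (exists a, v' = rcons v a) /\ G v'.

Lemma attempt_mkseq (s : seq nat -> bool) (lt : nat -> nat -> Prop)
    (dom : nat -> Prop) (x f : nat -> nat) n :
  (forall n, s (mkseq x n)) -> (forall k, dom (f k)) ->
  (forall i j, rel_of x i j -> lt (f i) (f j)) ->
  attempt s lt dom (mkseq (fun k => (x k, f k)) n).
Proof.
move=> xs fdom fhom.
have u1 : unzip1 (mkseq (fun k => (x k, f k)) n) = mkseq x n.
  by rewrite /unzip1 -map_comp.
have u2 : unzip2 (mkseq (fun k => (x k, f k)) n) = mkseq f n.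
  by rewrite /unzip2 -map_comp.
split; rewrite ?u1 ?u2 size_mkseq.
- move=> k kn; rewrite /mkseq -map_take take_iota; have -> : minn k n = k by apply/minn_idPl/ltnW.
  exact: xs.
- by move=> k kn; rewrite nth_mkseq.
- move=> i j ijn iN jN; rewrite !nth_mkseq //; exact: fhom.
Qed.

Lemma not_acc_attempt (s : seq nat -> bool) (lt : nat -> nat -> Prop)
    (dom : nat -> Prop) v :
  ~ Acc (extends (attempt s lt dom)) v ->
  exists x f, [/\ forall n, s (mkseq x n), forall k, dom (f k)
    & forall i j, rel_of x i j -> lt (f i) (f j)].
Proof.
move=> nacc; have [g g0 gP] := not_acc_path nacc.
have [sz [h gE]] := rcons_path_limit (0, 0)%N (fun n => (gP n).1).
rewrite g0 in sz.
have u1 n : unzip1 (g n) = mkseq (fun k => (h k).1) (size (g n)).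
  by rewrite {1}gE /unzip1 /mkseq -map_comp.
have u2 n : unzip2 (g n) = mkseq (fun k => (h k).2) (size (g n)).
  by rewrite {1}gE /unzip2 /mkseq -map_comp.
exists (fun k => (h k).1), (fun k => (h k).2); split.
- move=> n; have [_ [/(_ n) + _ _]] := gP n.
  have lt_n : (n < size (g n.+1))%N by rewrite sz addnS ltnS leq_addl.
  move=> /(_ lt_n); rewrite u1 /mkseq -map_take take_iota.
  by have -> : minn n (size (g n.+1)) = n by apply/minn_idPl/ltnW.
- move=> k; have [_ [_ /(_ k) + _]] := gP k.
  have lt_k : (k < size (g k.+1))%N by rewrite sz addnS ltnS leq_addl.
  by move=> /(_ lt_k); rewrite u2 nth_mkseq.
(* A stage long enough to contain all three indices. *)
- move=> i j rij; pose N := (pickle (i, j) + i + j)%N.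
  have [_ [_ _ /(_ i j)]] := gP N.
  have lt1 : (pickle (i, j) < size (g N.+1))%N.
    by rewrite sz addnS ltnS /N -addnA addnCA leq_addr.
  have lt2 : (i < size (g N.+1))%N.
    by rewrite sz addnS ltnS /N [X in (_ + (X + _))%N]addnC -addnA addnCA leq_addr.
  have lt3 : (j < size (g N.+1))%N by rewrite sz addnS ltnS /N addnA leq_addl.
  move=> /(_ lt1 lt2 lt3); rewrite u1 u2 !nth_mkseq //; exact.
Qed.

Definition slt (le : nat -> nat -> bool) (u v : nat) : Prop := le u v && ~~ le v u.

Definition partial_preorder (le : nat -> nat -> bool) : Prop :=
  [/\ forall u v, le u v -> le u u && le v v,
      forall u v w, le u v -> le v w -> le u w
    & forall u v, le u u -> le v v -> le u v || le v u].

(* The domain {u | le u u} plays the role of the well-founded part of K, and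
   le compares the ranks. *)
Definition exact_for (K : nat -> nat -> Prop) (le : nat -> nat -> bool) : Prop :=
  [/\ forall u c, le u u -> K c u -> slt le c u,
      forall u d, slt le d u -> exists2 c, K c u & le d c
    & forall u, ~~ le u u -> exists2 c, K c u & ~~ le c c].

Definition attempt_below s (le : nat -> nat -> bool) d :=
  attempt s (slt le) (fun c => slt le c d).

(* D d e is the e-th derivative of the tree of attempts below d. *)
Definition derivative_for s (le : nat -> nat -> bool)
    (D : nat -> nat -> seq (nat * nat) -> bool) : Prop :=
  forall d e v, le d d -> le e e ->
    (D d e v <-> forall e', slt le e' e ->
      exists2 a, attempt_below s le d (rcons v a) & D d e' (rcons v a)).

(** What is kept of the well-foundedness of the tree of attempts below [d]: if the root survives the
    derivative [D d e], some surviving attempt has no surviving extension. Only countable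
    quantifiers occur, so the condition is arithmetical. *)
Definition leaf_property s (le : nat -> nat -> bool)
    (D : nat -> nat -> seq (nat * nat) -> bool) : Prop :=
  forall d e, le d d -> le e e -> D d e [::] ->
    exists v, [/\ attempt_below s le d v, D d e v
      & forall a, attempt_below s le d (rcons v a) -> ~~ D d e (rcons v a)].

Definition pseudo_rank K s le D : Prop :=
  [/\ partial_preorder le, exact_for K le, derivative_for s le D
    & leaf_property s le D].

(** Only proper initial segments are tested by [attempt], so the root is an attempt even if [s [::]]
    fails. *)
Lemma attempt_nil s lt dom : attempt s lt dom [::].
Proof. by split. Qed.

Lemma rk_le_of_lt A B (ra : A -> A -> Prop) (rb : B -> B -> Prop) a b :
  Acc ra a -> rk_lt ra rb a b -> rk_le ra rb a b.
Proof.
move=> acca; elim: acca b => {}a _ ih b [b' bb' [h]].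
constructor=> a' aa'; exists b'; first exact: bb'.
exact: ih aa' _ (h _ aa').
Qed.

(** True ranks are taken throughout. The trees of attempts are well-founded: an infinite attempt is
    a branch of [s] with a homomorphism into the well-founded [slt le], which would make the coded
    relation well-founded. *)
Lemma pseudo_rank_exists (K : nat -> nat -> Prop) (s : seq nat -> bool) :
  ~ has_wf_branch s -> exists le D, pseudo_rank K s le D.
Proof.
move=> ns.
pose le u v := `[< [/\ Acc K u, Acc K v & rk_le K K u v] >].
have leP u v : le u v <-> [/\ Acc K u, Acc K v & rk_le K K u v].
  by split=> [/asboolP|h]; [|apply/asboolP].
have leuu u : le u u <-> Acc K u.
  split=> [/leP[]//|au]; apply/leP; split; [exact: au|exact: au|exact: rk_le_refl].
have sltP u v : slt le u v <-> [/\ Acc K u, Acc K v & rk_lt K K u v].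
  split=> [/andP[/leP[au av uv] nvu]|[au av uv]].
    split; [exact: au|exact: av|].
    have [vu|] := rk_le_lt_total K u av; last exact.
    by case/negP: nvu; apply/leP; split.
  apply/andP; split; first by apply/leP; split; [| |exact: rk_le_of_lt].
  by apply/negP => /leP[_ _ vu]; exact: rk_le_ltF vu uv.
have wfslt : well_founded (slt le).
  suff acc u : Acc K u -> Acc (slt le) u.
    move=> u; constructor=> v /sltP[av _ _]; exact: acc.
  (* The claim is generalized to all [b] of rank at most that of [a]: whatever has smaller rank than
     [b] is dominated by some [a'] below [a]. *)
  suff key a : Acc K a -> forall b, rk_le K K b a -> Acc K b -> Acc (slt le) b.
    by move=> au; exact: (key _ au _ (rk_le_refl au) au).
  elim=> {}a acca ih b [ba] ab; constructor=> c /sltP[ac _ [b' bb' cb']].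
  have [a' aa' ba'] := ba _ bb'.
  exact: (ih _ aa' _ (rk_le_trans ac cb' ba') ac).
pose J d := extends (attempt_below s le d).
have wfJ d v : Acc (J d) v.
  apply: contra_notP ns => /not_acc_attempt[x [f [xs _ fhom]]].
  exists x; first exact: xs.
  move=> i.
  suff key b : Acc (slt le) b -> forall i, f i = b -> Acc (rel_of x) i.
    exact: (key _ (wfslt (f i)) i erefl).
  elim=> {}b _ ih {}i fi; constructor=> j /fhom ji.
  by apply: (ih (f j) _ _ erefl); rewrite -fi.
(* An attempt survives the [e]-th derivative iff its rank is at least that of [e]. *)
pose D d e v := `[< rk_le (slt le) (J d) e v >].
exists le, D; split.
- split.
  + by move=> u v /leP[au av _]; apply/andP; split; apply/leuu.
  + move=> u v w /leP[au av uv] /leP[_ aw vw]; apply/leP; split; [exact: au|exact: aw|].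
    exact: rk_le_trans uv vw.
  + move=> u v /leuu au /leuu av.
    have [uv|vu] := rk_le_lt_total K v au; apply/orP; [left|right]; apply/leP; split => //.
    exact: rk_le_of_lt.
- split.
  + move=> u c /leuu au cu; apply/sltP; split; [exact: Acc_inv cu|exact: au|].
    exists c; [exact: cu|apply: rk_le_refl; exact: Acc_inv cu].
  + move=> u d /sltP[ad au [c cu dc]]; exists c; first exact: cu.
    apply/leP; split; [exact: ad|exact: Acc_inv cu|exact: dc].
  + move=> u /negP nu; have nacc : ~ Acc K u by move/leuu.
    have [c cu nc] := not_acc_step nacc.
    by exists c => //; apply/negP => /leuu.
- move=> d e v _ _; split.
    move=> /asboolP[h] e' /h[v' [[a ->] att] le']; exists a; first exact: att.
    by apply/asboolP.
  move=> h; apply/asboolP; constructor=> e' /h[a att /asboolP le'].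
  by exists (rcons v a) => //; split=> //; exists a.
- move=> d e _ _ D0.
  have [v [[attv Dv] _ vmin]] : exists b, [/\ attempt_below s le d b /\ D d e b, Acc (J d) b &
      forall c, J d c b -> ~ (attempt_below s le d c /\ D d e c)].
    apply: (acc_min (P := fun v => attempt_below s le d v /\ D d e v) (wfJ d [::])).
    by split=> //; exact: attempt_nil.
  exists v; split=> // a atta; apply/negP => Da; apply: (vmin (rcons v a)) => //.
  by split=> //; exists a.
Qed.

Lemma slt_trans_dom le u v : partial_preorder le -> slt le u v -> le u u /\ le v v.
Proof. by case=> h _ _ /andP[/h/andP[]]. Qed.

Lemma le_rk_le le u v : partial_preorder le -> Acc (slt le) u -> le u v ->
  rk_le (slt le) (slt le) u v.
Proof.
move=> [_ tr _] au uv; constructor=> w wu; exists w.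
  case/andP: wu => wu nuw; apply/andP; split; first exact: tr uv.
  by apply: contra nuw => vw; exact: tr vw.
exact: rk_le_refl (Acc_inv au wu).
Qed.

(* The rank of an attempt below d depends on R only: each value of the attempt is
   replaced by an element of R of the same rank. *)
Section Transport.
Context (s : seq nat -> bool) (le : nat -> nat -> bool) (R : nat -> nat -> Prop).
Context (le_pre : partial_preorder le) (R_wf : well_founded R).
Context (d : nat) (d_acc : Acc (slt le) d).

Let same i c := rk_le R (slt le) i c /\ rk_le (slt le) R c i.

Context (same_of_R : forall i, exists2 c, slt le c d & same i c).
Context (same_of_le : forall c, slt le c d -> exists i, same i c).

Let accl c : slt le c d -> Acc (slt le) c.
Proof. by move=> cd; exact: (Acc_inv d_acc cd). Qed.

(** Below the accessible [d], [slt le] is the comparison of true ranks: [le] is total on its domain,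
    and [le c' c] would bound the rank of [c'] by that of [c]. *)
Lemma same_lt i j c c' : slt le c d -> slt le c' d -> same i c -> same j c' ->
  (rk_lt R R i j <-> slt le c c').
Proof.
move=> cd cd' [ic ci] [jc jc']; split=> [ij|cc'].
  have lt_cc' : rk_lt (slt le) (slt le) c c'.
    apply: rk_le_lt_trans (accl cd) ci _.
    exact: rk_lt_le_trans (R_wf i) ij jc.
  have [_ _ tot] := le_pre.
  have [lecc _] := slt_trans_dom le_pre cd; have [lecc' _] := slt_trans_dom le_pre cd'.
  have nle : ~~ le c' c.
    apply/negP => c'c; have := le_rk_le le_pre (accl cd') c'c.
    by move=> /(rk_le_ltF (accl cd')); exact.
  apply/andP; split=> //.
  by have := tot _ _ lecc lecc'; rewrite (negPf nle) orbF.
apply: rk_le_lt_trans (R_wf i) ic _.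
apply: rk_lt_le_trans (accl cd) _ jc'.
by exists c => //; exact: rk_le_refl (accl cd).
Qed.

Let similar (v v' : seq (nat * nat)) :=
  unzip1 v = unzip1 v' /\ forall k, (k < size v)%N ->
    same (nth 0 (unzip2 v) k)%N (nth 0 (unzip2 v') k)%N.

Let Jd := extends (attempt_below s le d).
Let Jr := extends (attempt s (rk_lt R R) (fun _ => True)).

Let similar_size v v' : similar v v' -> size v = size v'.
Proof. by move=> [/(congr1 size)]; rewrite !size_map. Qed.

Let similar_attempt v v' : similar v v' ->
  (forall k, (k < size v')%N -> slt le (nth 0 (unzip2 v') k)%N d) ->
  attempt s (rk_lt R R) (fun _ => True) v <-> attempt_below s le d v'.
Proof.
move=> sim dom; have sz := similar_size sim; case: sim => u1 sim.
split=> -[h1 h2 h3]; split.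
- by rewrite -sz -u1.
- exact: dom.
- move=> i j; rewrite -sz -u1 => ij iv jv o.
  apply/(same_lt _ _ (sim _ iv) (sim _ jv)); [by apply: dom; rewrite -sz|by apply: dom; rewrite -sz|].
  exact: h3.
- by rewrite sz u1.
- by [].
- move=> i j ij iv jv o.
  apply/(same_lt _ _ (sim _ iv) (sim _ jv)); [by apply: dom; rewrite -sz|by apply: dom; rewrite -sz|].
  by apply: h3; rewrite -?sz -?u1.
Qed.

Let similar_rcons v v' n i c : similar v v' -> same i c ->
  similar (rcons v (n, i)) (rcons v' (n, c)).
Proof.
move=> sim ic; have sz := similar_size sim; case: sim => u1 sim.
split; first by rewrite /unzip1 !map_rcons -!/(unzip1 _) u1.
move=> k; rewrite size_rcons ltnS /unzip2 !map_rcons !nth_rcons !size_map -sz.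
rewrite leq_eqVlt => /predU1P[->|kv]; first by rewrite ltnn eqxx.
by rewrite kv; exact: sim.
Qed.

Let attempt_dom v : attempt_below s le d v ->
  forall k, (k < size v)%N -> slt le (nth 0 (unzip2 v) k)%N d.
Proof. by case. Qed.

Let dom_rcons v n c : attempt_below s le d v -> slt le c d ->
  forall k, (k < size (rcons v (n, c)))%N -> slt le (nth 0 (unzip2 (rcons v (n, c))) k)%N d.
Proof.
move=> /attempt_dom vd cd k; rewrite size_rcons ltnS /unzip2 map_rcons nth_rcons size_map.
rewrite leq_eqVlt => /predU1P[->|kv]; first by rewrite ltnn eqxx.
by rewrite kv; exact: vd.
Qed.

(** One half of a back-and-forth between the two trees of attempts, with [child_to_le] as the other
    half. This half transports rank bounds, the other one transports well-foundedness. *)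
Let child_from_le v v' a' : similar v v' -> attempt_below s le d (rcons v' a') ->
  exists a, attempt s (rk_lt R R) (fun _ => True) (rcons v a) /\
    similar (rcons v a) (rcons v' a').
Proof.
case: a' => n c sim att.
have cd : slt le c d.
  have := attempt_dom att (k := size v'); rewrite size_rcons ltnSn => /(_ erefl).
  by rewrite /unzip2 map_rcons nth_rcons size_map ltnn eqxx.
have [i ic] := same_of_le cd.
exists (n, i); have sim' := similar_rcons n sim ic; split => //.
exact/(similar_attempt sim' (attempt_dom att)).
Qed.

Let child_to_le v v' a : similar v v' -> attempt_below s le d v' ->
  attempt s (rk_lt R R) (fun _ => True) (rcons v a) ->
  exists a', attempt_below s le d (rcons v' a') /\ similar (rcons v a) (rcons v' a').
Proof.
case: a => n i sim att' att.
have [c cd ic] := same_of_R i.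
exists (n, c); have sim' := similar_rcons n sim ic; split => //.
exact/(similar_attempt sim' (dom_rcons att' cd)).
Qed.

Let similar_acc v v' : similar v v' -> attempt_below s le d v' -> Acc Jd v' -> Acc Jr v.
Proof.
move=> sim att acc; elim: acc v sim att => {}v' _ ih v sim att.
constructor=> _ [[a ->] atta].
have [a' [atta' sim']] := child_to_le sim att atta.
by apply: (ih (rcons v' a')) => //; split=> //; exists a'.
Qed.

Let similar_rk e v v' : Acc (slt le) e -> similar v v' ->
  rk_le (slt le) Jd e v' -> rk_le (slt le) Jr e v.
Proof.
move=> acce; elim: acce v v' => {}e _ ih v v' sim [h].
constructor=> e' e'e; have [_ [[a' ->] atta'] le'] := h _ e'e.
have [a [atta sim']] := child_from_le sim atta'.
exists (rcons v a); first by split=> //; exists a.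
exact: (ih _ e'e _ _ sim').
Qed.

Lemma transport_rk e v' : Acc (slt le) e -> attempt_below s le d v' -> Acc Jd v' ->
  rk_le (slt le) Jd e v' -> exists2 v, Acc Jr v & rk_le (slt le) Jr e v.
Proof.
move=> acce att acc ev.
have /choice[g gP] : forall c, exists i, slt le c d -> same i c.
  move=> c; have [cd|ncd] := pselect (slt le c d); last by exists 0%N.
  by have [i ic] := same_of_le cd; exists i.
pose v := map (fun p => (p.1, g p.2)) v'.
have sim : similar v v'.
  split; first by rewrite /unzip1 -map_comp.
  move=> k; rewrite size_map => kv.
  rewrite /unzip2 -map_comp !(nth_map (0, 0)%N) //=; apply: gP.
  by have := attempt_dom att kv; rewrite /unzip2 (nth_map (0, 0)%N).
exists v; [exact: similar_acc att acc|exact: similar_rk ev].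
Qed.
End Transport.

(* The bound depends on the branch x only. For the least d whose rank reaches
   that of R, ill-founded attempts below d survive all derivatives D d e' with e'
   in the well-founded part. The attempt provided by the leaf property is
   therefore well-founded, and its rank is an upper bound for e. *)
Lemma wf_part_bounded (s : seq nat -> bool) (x : nat -> nat) K le D e :
  (forall n, s (mkseq x n)) -> well_founded (rel_of x) -> pseudo_rank K s le D ->
  let R := rel_of x in
  let J := extends (attempt s (rk_lt R R) (fun _ => True)) in
  le e e -> Acc (slt le) e ->
  (exists i, rk_le (slt le) R e i) \/ (exists2 v, Acc J v & rk_le (slt le) J e v).
Proof.
move=> xs Rwf [pre exact der leaf] R J lee acce.
have [|nR] := pselect (exists i, rk_le (slt le) R e i); first by left.
right.
have [d [[led nRd] accd mind]] : exists b, [/\ le b b /\ ~ (exists i, rk_le (slt le) R b i),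
    Acc (slt le) b & forall c, slt le c b -> ~ (le c c /\ ~ (exists i, rk_le (slt le) R c i))].
  exact: (acc_min (P := fun b => le b b /\ ~ (exists i, rk_le (slt le) R b i)) acce).
have accl c : slt le c d -> Acc (slt le) c by move=> cd; exact: (Acc_inv accd cd).
have to_R c : slt le c d -> exists i, rk_le (slt le) R c i.
  move=> cd; have [lec _] := slt_trans_dom pre cd.
  by apply: contra_notP (mind _ cd) => h.
have same_of_le c : slt le c d -> exists i, rk_le R (slt le) i c /\ rk_le (slt le) R c i.
  move=> cd; have [i0 ci0] := to_R _ cd.
  (* Minimality turns the upper bound [i] into an element of the same rank as [c]. *)
  have [i [ci _ mini]] := acc_min (P := fun i => rk_le (slt le) R c i) (Rwf i0) ci0.
  exists i; split; last exact: ci.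
  have [|[i' ii' ci']] := rk_le_lt_total (slt le) c (Rwf i); first exact.
  by case: (mini _ ii').
have same_of_R i : exists2 c, slt le c d & rk_le R (slt le) i c /\ rk_le (slt le) R c i.
  have [di|[c0 c0d ic0]] := rk_le_lt_total R i accd.
    by case: nRd; exists i.
  have [c [[cd ic] accc minc]] := acc_min (P := fun c => slt le c d /\ rk_le R (slt le) i c)
    (accl _ c0d) (conj c0d ic0).
  exists c; first exact: cd.
  split; first exact: ic.
  have [|[c' cc' ic']] := rk_le_lt_total R i accc; first exact.
  case: (minc _ cc'); split => //.
  case: pre => _ tr _; case/andP: cc' => cc' nc'c; case/andP: cd => cd ndc.
  apply/andP; split; first exact: tr cd.
  by apply: contra ndc => dc'; exact: tr dc' cc'.
(* Every rank of [R] is attained below [d], so the relation coded by [x] maps homomorphically into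
   the nodes below [d]. Hence the empty attempt is ill-founded. *)
have /choice[f fP] : forall i, exists c, slt le c d /\
    (rk_le R (slt le) i c /\ rk_le (slt le) R c i).
  by move=> i; have [c cd h] := same_of_R i; exists c.
have fhom i j : rel_of x i j -> slt le (f i) (f j).
  move=> ij; apply/(@same_lt le R pre Rwf d accd i j) => //; [exact: (fP i).1|exact: (fP j).1|exact: (fP i).2|exact: (fP j).2|].
  exists i; [exact: ij|exact: rk_le_refl].
pose Jd := extends (attempt_below s le d).
have nacc0 : ~ Acc Jd [::].
  pose p n := mkseq (fun k => (x k, f k)) n.
  apply: (@path_not_acc _ Jd p) => n; split.
    by exists (x n, f n); rewrite /p /mkseq -addn1 iotaD map_cat cats1.
  by apply: attempt_mkseq => // k; exact: (fP k).1.
have ill e' v : Acc (slt le) e' -> le e' e' -> ~ Acc Jd v -> D d e' v.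
  move=> acce'; elim: acce' v => {}e' _ ih v lee' nv; apply/der => // e'' e''e'.
  have [_ [[a ->] attw] naw] := not_acc_step nv.
  have [lee'' _] := slt_trans_dom pre e''e'.
  by exists a => //; exact: ih.
have [v [attv Dv leafv]] := leaf _ _ led lee (ill _ _ acce lee nacc0).
have accv : Acc Jd v.
  apply: contrapT => nv; have [w [[a wE] attw] naw] := not_acc_step nv.
  rewrite wE in attw naw; have /negP := leafv _ attw; apply.
  exact: ill.
have ev : rk_le (slt le) Jd e v.
  move=> {leafv attv accv nR}.
  elim: acce lee v Dv => {}e _ ih lee v /(der _ _ _ led lee) h; constructor=> e' e'e.
  have [lee' _] := slt_trans_dom pre e'e.
  have [a atta Da] := h _ e'e; exists (rcons v a); first by split=> //; exists a.
  exact: ih.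
have [v' accv' ev'] := transport_rk pre Rwf accd same_of_R same_of_le acce attv accv ev.
by exists v'.
Qed.

(** [G] collects the nodes which look ill-founded to [le]; a path that stays in [G] never gets
    stuck. If an inaccessible [d] lies below [u], the child [c] of [u] with [le d c] is inaccessible
    too, as everything below [d] is below [c]. *)
Lemma exact_step K le : partial_preorder le -> exact_for K le ->
  let G u := ~~ le u u \/ ~ Acc (slt le) u in
  forall u, G u -> exists2 c, K c u & G c.
Proof.
move=> pre [_ ex top] G u [nu|nacc].
  by have [c cu nc] := top _ nu; exists c => //; left.
have [d du nd] := not_acc_step nacc.
have [c cu dc] := ex _ _ du; exists c => //; right => accc.
apply: nd; constructor=> b bd; apply: (Acc_inv accc).
case: pre => _ tr _; case/andP: bd => bd ndb; apply/andP; split; first exact: tr dc.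
by apply: contra ndb => cb; exact: tr dc cb.
Qed.

(** A child in [K] of a node of the domain is strictly smaller, so accessibility for [slt le]
    implies accessibility for [K]. *)
Lemma exact_root K le u : partial_preorder le -> exact_for K le -> ~ Acc K u ->
  ~~ le u u \/ ~ Acc (slt le) u.
Proof.
move=> pre [down _ _] nu; have [luu|] := boolP (le u u); last by left.
right=> acc; apply: nu; elim: acc luu => {}u _ ih luu; constructor=> c cu.
have cltu := down _ _ luu cu; apply: (ih _ cltu).
by have [] := slt_trans_dom pre cltu.
Qed.

Local Open Scope classical_set_scope.

(** * Baire space *)

(** Continuity into [U] with the discrete topology, for an arbitrary type [U]. *)
Definition lconst (T : topologicalType) (U : Type) (h : T -> U) : Prop :=
  forall t, \forall t' \near t, h t' = h t.

Lemma lconst_cst (T : topologicalType) (U : Type) (u : U) : lconst (fun _ : T => u).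
Proof. by move=> t; exact: nearW. Qed.

Lemma lconst_comp (T : topologicalType) U V (h : T -> U) (g : U -> V) :
  lconst h -> lconst (fun t => g (h t)).
Proof. by move=> lh t; near do apply: congr1; exact: lh. Unshelve. all: by end_near. Qed.

Lemma lconst_pair (T : topologicalType) U V (h : T -> U) (g : T -> V) :
  lconst h -> lconst g -> lconst (fun t => (h t, g t)).
Proof.
move=> lh lg t; have := lh t; have := lg t; apply: filterS2 => t' -> -> //.
Qed.

Lemma lconst_cont (T T' : topologicalType) U (f : T -> T') (h : T' -> U) :
  continuous f -> lconst h -> lconst (fun t => h (f t)).
Proof. by move=> cf lh t; exact: (cf t _ (lh (f t))). Qed.

Lemma lconst_open (T : topologicalType) U (h : T -> U) (P : U -> Prop) :
  lconst h -> open [set t | P (h t)].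
Proof.
by move=> lh; rewrite openE => t /= Pt; have := lh t; apply: filterS => t' /= ->.
Qed.

Lemma lconst_closed (T : topologicalType) U (h : T -> U) (P : U -> Prop) :
  lconst h -> closed [set t | P (h t)].
Proof. by move=> lh; rewrite -openC; exact: (@lconst_open _ _ h (fun u => ~ P u)). Qed.

Lemma continuous_fst (T U : topologicalType) : continuous (@fst T U).
Proof. by move=> x; exact: cvg_fst. Qed.

Lemma continuous_snd (T U : topologicalType) : continuous (@snd T U).
Proof. by move=> x; exact: cvg_snd. Qed.

Lemma continuous_pair (S T U : topologicalType) (f : S -> T) (g : S -> U) :
  continuous f -> continuous g -> continuous (fun x => (f x, g x)).
Proof. by move=> cf cg x; apply: cvg_pair; [exact: cf|exact: cg]. Qed.

Lemma continuous_compose (S T U : topologicalType) (f : S -> T) (g : T -> U) :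
  continuous f -> continuous g -> continuous (fun x => g (f x)).
Proof. by move=> cf cg x; apply: continuous_comp; [exact: cf|exact: cg]. Qed.

Lemma open_preimage (T U : topologicalType) (f : T -> U) (A : set U) :
  continuous f -> open A -> open (f @^-1` A).
Proof. by move=> /continuousP; exact. Qed.

Lemma closed_preimage (T U : topologicalType) (f : T -> U) (A : set U) :
  continuous f -> closed A -> closed (f @^-1` A).
Proof. by move=> cf; rewrite -!openC; exact: open_preimage. Qed.

Lemma lconst_coord n : lconst (fun x : baire => x n).
Proof.
move=> x; apply: (@proj_continuous nat (fun=> nat) n x [set m | m = x n]).
exact/principal_filterP.
Qed.

Lemma lconst_mkseq_fun (T : topologicalType) (f : T -> nat -> nat) n :
  (forall k, lconst (fun t => f t k)) -> lconst (fun t => mkseq (f t) n).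
Proof.
move=> lf; elim: n => [|n ih]; first exact: lconst_cst.
have -> : (fun t => mkseq (f t) n.+1) = (fun t => rcons (mkseq (f t) n) (f t n)).
  by apply/funext => t; rewrite -addn1 /mkseq iotaD map_cat cats1.
exact: (lconst_comp (fun p => rcons p.1 p.2) (lconst_pair ih (lf n))).
Qed.

Lemma lconst_mkseq n : lconst (fun x : baire => mkseq x n).
Proof. apply: lconst_mkseq_fun; exact: lconst_coord. Qed.

(** The filter generated by the cylinders around [x] converges to [x] in each coordinate, hence in
    the product topology, which is a supremum. *)
Lemma nbhs_baireP (x : baire) (A : set baire) :
  nbhs x A <-> exists n, forall y : baire, mkseq y n = mkseq x n -> A y.
Proof.
split; last first.
  move=> [n h]; exact: (filterS (h : [set y : baire | mkseq y n = mkseq x n] `<=` A) (lconst_mkseq n x)).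
pose F : set_system baire :=
  filter_from [set: nat] (fun n => [set y : baire | mkseq y n = mkseq x n]).
have agree (y : baire) n m : (m <= n)%N -> mkseq y n = mkseq x n -> mkseq y m = mkseq x m.
  by move=> mn /(congr1 (take m)); rewrite /mkseq -!map_take !take_iota (minn_idPl mn).
have FF : Filter F.
  apply: filter_from_filter; first by exists 0%N.
  move=> n m _ _; exists (maxn n m) => // y h.
  by split; apply: agree h; rewrite ?leq_maxl ?leq_maxr.
suff Fx : F --> x by move=> /Fx[n _ h]; exists n.
apply/cvg_sup => n B [V] [[W] oW <-] Wx WB.
apply: (filterS WB); exists n.+1 => // y /= h.
have := congr1 (fun s => nth 0%N s n) h; rewrite !nth_mkseq //= => yn.
by rewrite /= yn.
Qed.

Lemma continuous_baire (T : topologicalType) (f : T -> baire) :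
  (forall n, lconst (fun t => f t n)) -> continuous f.
Proof.
move=> lf t A /nbhs_baireP[n h].
have := lconst_mkseq_fun n lf t; by apply: filterS => y; exact: h.
Qed.

Definition slice (k : nat) (x : baire) : baire := fun n => x (pickle (k, n)).

Definition glue (F : nat -> baire) : baire := fun m =>
  if (unpickle m : option (nat * nat)) is Some (k, n) then F k n else 0%N.

Lemma slice_glue F k : slice k (glue F) = F k.
Proof. by apply/funext => n; rewrite /slice /glue pickleK. Qed.

Definition join (x y : baire) : baire := glue (fun k => if k is 0%N then x else y).

Lemma slice0_join x y : slice 0 (join x y) = x.
Proof. exact: slice_glue. Qed.

Lemma slice1_join x y : slice 1 (join x y) = y.
Proof. exact: slice_glue. Qed.

Lemma continuous_slice k : continuous (slice k).
Proof. by apply: continuous_baire => n; exact: lconst_coord. Qed.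

Lemma continuous_glue (T : topologicalType) (f : nat -> T -> baire) :
  (forall k, continuous (f k)) -> continuous (fun t => glue (fun k => f k t)).
Proof.
move=> cf; apply: continuous_baire => m; rewrite /glue.
case: (unpickle m : option (nat * nat)) => [[k n]|]; last exact: lconst_cst.
exact: (lconst_cont (cf k) (@lconst_coord n)).
Qed.

Lemma continuous_join (T : topologicalType) (f g : T -> baire) :
  continuous f -> continuous g -> continuous (fun t => join (f t) (g t)).
Proof.
move=> cf cg; pose h k := if k is 0%N then f else g.
have -> : (fun t => join (f t) (g t)) = (fun t => glue (fun k => h k t)).
  by apply/funext => t; congr glue; apply/funext => -[].
by apply: continuous_glue => -[].
Qed.

(** * Sigma-algebras as logics *)

Section SigmaLogic.
Context {T : Type} {G : set (set T)} (sG : sigma_algebra setT G).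

(** This and the following lemmas treat one connective or countable quantifier each, so that proofs
    of definability can follow the syntax of a formula. *)
Lemma sa_not (P : T -> Prop) : G [set t | P t] -> G [set t | ~ P t].
Proof. by case: sG => _ h _ /h; rewrite setTD. Qed.

Lemma sa_const (P : Prop) : G [set _ | P].
Proof.
case: sG => h0 h1 _; have [p|np] := pselect P.
  have -> : [set _ : T | P] = setT by apply/seteqP; split.
  by rewrite -(setD0 setT); exact: h1.
have -> : [set _ : T | P] = set0 by apply/seteqP; split.
exact: h0.
Qed.

Lemma sa_exists (I : countType) (P : I -> T -> Prop) :
  (forall i, G [set t | P i t]) -> G [set t | exists i, P i t].
Proof.
case: sG => h0 _ hU hP.
pose F n : set T := if (unpickle n : option I) is Some i then [set t | P i t] else set0.
have -> : [set t | exists i, P i t] = \bigcup_n F n.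
  apply/seteqP; split=> t /=.
    by move=> [i Pi]; exists (pickle i) => //; rewrite /F pickleK.
  by move=> [n _]; rewrite /F; case: unpickle => // i Pi; exists i.
by apply: hU => n; rewrite /F; case: unpickle.
Qed.

Lemma sa_ext (P Q : T -> Prop) : (forall t, P t <-> Q t) -> G [set t | P t] -> G [set t | Q t].
Proof. by move=> PQ; congr G; apply/seteqP; split=> t /PQ. Qed.

Lemma sa_or (P Q : T -> Prop) : G [set t | P t] -> G [set t | Q t] -> G [set t | P t \/ Q t].
Proof.
move=> hP hQ; apply: (@sa_ext (fun t => exists b : bool, if b then P t else Q t)).
  by move=> t; split=> [[[]]|[]]; [left|right|exists true|exists false].
by apply: sa_exists => -[].
Qed.

Lemma sa_and (P Q : T -> Prop) : G [set t | P t] -> G [set t | Q t] -> G [set t | P t /\ Q t].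
Proof.
move=> hP hQ; apply: (@sa_ext (fun t => ~ (~ P t \/ ~ Q t))).
  by move=> t; rewrite not_orE !notK.
by apply: sa_not; apply: sa_or; exact: sa_not.
Qed.

Lemma sa_imp (P Q : T -> Prop) : G [set t | P t] -> G [set t | Q t] -> G [set t | P t -> Q t].
Proof.
move=> hP hQ; apply: (@sa_ext (fun t => ~ P t \/ Q t)).
  by move=> t; rewrite implyE.
by apply: sa_or => //; exact: sa_not.
Qed.

Lemma sa_iff (P Q : T -> Prop) : G [set t | P t] -> G [set t | Q t] -> G [set t | P t <-> Q t].
Proof. by move=> hP hQ; apply: sa_and; exact: sa_imp. Qed.

Lemma sa_forall (I : countType) (P : I -> T -> Prop) :
  (forall i, G [set t | P i t]) -> G [set t | forall i, P i t].
Proof.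
move=> hP; apply: (@sa_ext (fun t => ~ exists i, ~ P i t)).
  by move=> t; rewrite existsNE notK.
by apply: sa_not; apply: sa_exists => i; exact: sa_not.
Qed.

Lemma sa_exists2 (I : countType) (P Q : I -> T -> Prop) :
  (forall i, G [set t | P i t]) -> (forall i, G [set t | Q i t]) ->
  G [set t | exists2 i, P i t & Q i t].
Proof.
move=> hP hQ; apply: (@sa_ext (fun t => exists i, P i t /\ Q i t)).
  by move=> t; split=> -[i]; [case|]; exists i.
by apply: sa_exists => i; exact: sa_and.
Qed.

End SigmaLogic.

(** * Analytic sets *)

Section Analytic.
Context {T : topologicalType}.

Lemma Sigma11P (A : set T) : Sigma11 A <->
  exists2 C : set (T * baire), closed C & forall t, A t <-> exists b, C (t, b).
Proof.
split=> [[C cC ->]|[C cC h]]; exists C => //.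
  by move=> t; split=> [[[u b] Cub <-]|[b Ctb]]; [exists b|exists (t, b)].
apply/seteqP; split=> t; first by move=> /h[b Ctb]; exists (t, b).
by move=> [[u b] Cub <-]; apply/h; exists b.
Qed.

Lemma Sigma11_closed (A : set T) : closed A -> Sigma11 A.
Proof.
move=> cA; apply/Sigma11P; exists (fst @^-1` A).
  by apply: closed_preimage => //; exact: continuous_fst.
by move=> t; split=> [At|[b]] //; exists (fun=> 0%N).
Qed.

Lemma Sigma11_ext (A B : set T) : (forall t, A t <-> B t) -> Sigma11 A -> Sigma11 B.
Proof. by move=> AB; congr Sigma11; apply/seteqP; split=> t /AB. Qed.

Lemma Sigma11_forall (A : nat -> set T) :
  (forall n, Sigma11 (A n)) -> Sigma11 [set t | forall n, A n t].
Proof.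
move=> hA; have /choice[C CP] : forall n, exists C : set (T * baire),
    closed C /\ forall t, A n t <-> exists b, C (t, b).
  by move=> n; have /Sigma11P[C cC h] := hA n; exists C.
apply/Sigma11P; exists (\bigcap_n ((fun p : T * baire => (p.1, slice n p.2)) @^-1` C n)).
  apply: closed_bigI => n _; apply: closed_preimage; last exact: (CP n).1.
  apply: continuous_pair; first exact: continuous_fst.
  apply: continuous_compose; [exact: continuous_snd|exact: continuous_slice].
move=> t; split=> [/= At|[b h] n].
  have /choice[F FP] : forall n, exists b, C n (t, b) by move=> n; exact/(CP n).2.
  by exists (glue F) => n _ /=; rewrite slice_glue.
by apply/(CP n).2; exists (slice n b); exact: h.
Qed.

(** The witness stores the index in its first coordinate. For every other index the condition is
    void, which costs only a clopen set. *)
Lemma Sigma11_exists (A : nat -> set T) :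
  (forall n, Sigma11 (A n)) -> Sigma11 [set t | exists n, A n t].
Proof.
move=> hA; have /choice[C CP] : forall n, exists C : set (T * baire),
    closed C /\ forall t, A n t <-> exists b, C (t, b).
  by move=> n; have /Sigma11P[C cC h] := hA n; exists C.
apply/Sigma11P; exists (\bigcap_n ([set p : T * baire | slice 0 p.2 0%N <> n] `|`
   ((fun p : T * baire => (p.1, slice 1 p.2)) @^-1` C n))).
  apply: closed_bigI => n _; apply: closedU.
    apply: (@lconst_closed _ _ (fun p : T * baire => slice 0 p.2 0%N) (fun m => m <> n)).
    apply: (lconst_cont (h := fun x : baire => slice 0 x 0%N)); last exact: lconst_coord.
    exact: continuous_snd.
  apply: closed_preimage; last exact: (CP n).1.
  apply: continuous_pair; first exact: continuous_fst.
  apply: continuous_compose; [exact: continuous_snd|exact: continuous_slice].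
move=> t; split=> /= [[n /(CP n).2[b Cb]]|[b h]].
  exists (join (fun=> n) b) => m _ /=; rewrite slice0_join slice1_join.
  by have [<-|/eqP] := eqVneq n m; [right|left].
exists (slice 0 b 0%N); apply/(CP _).2; exists (slice 1 b).
by case: (h (slice 0 b 0%N) I).
Qed.

End Analytic.

Lemma Sigma11_project (T : topologicalType) (A : set (T * baire)) :
  Sigma11 A -> Sigma11 [set t | exists b, A (t, b)].
Proof.
move=> /Sigma11P[C cC h]; apply/Sigma11P.
exists ((fun p : T * baire => ((p.1, slice 0 p.2), slice 1 p.2)) @^-1` C).
  apply: closed_preimage => //; apply: continuous_pair; first apply: continuous_pair.
  - exact: continuous_fst.
  - apply: continuous_compose; [exact: continuous_snd|exact: continuous_slice].
  - apply: continuous_compose; [exact: continuous_snd|exact: continuous_slice].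
move=> t; split=> [[b /h[c Cc]]|[b Cb]].
  by exists (join b c); rewrite /= slice0_join slice1_join.
by exists (slice 0 b); apply/h; exists (slice 1 b).
Qed.

Lemma Sigma11_preimage (T U : topologicalType) (f : T -> U) (A : set U) :
  continuous f -> Sigma11 A -> Sigma11 (f @^-1` A).
Proof.
move=> cf /Sigma11P[C cC h]; apply/Sigma11P.
exists ((fun p : T * baire => (f p.1, p.2)) @^-1` C); last by move=> t; exact: h.
apply: closed_preimage => //; apply: continuous_pair; last exact: continuous_snd.
apply: continuous_compose => //; exact: continuous_fst.
Qed.

(** A sigma-algebra that contains the clopen sets and consists of analytic sets: arithmetical
    conditions fall into it by induction on their syntax. *)
Definition Delta11 (T : topologicalType) : set (set T) :=
  [set A | Sigma11 A /\ Sigma11 (~` A)].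

Lemma sigma_algebra_Delta11 (T : topologicalType) : sigma_algebra setT (@Delta11 T).
Proof.
split.
- split; first exact/Sigma11_closed/closed0.
  by rewrite setC0; exact/Sigma11_closed/closedT.
- by move=> A [h1 h2]; rewrite setTD; split => //; rewrite setCK.
- move=> A hA; split.
    apply: (@Sigma11_ext _ [set t | exists n, A n t]).
      by move=> t; split=> [[n ?]|[n]]; exists n.
    by apply: Sigma11_exists => n; case: (hA n).
  apply: (@Sigma11_ext _ [set t | forall n, (~` A n) t]).
    by move=> t; rewrite setC_bigcup; split=> [h n _|h n]; [exact: h|exact: h].
  by apply: Sigma11_forall => n; case: (hA n).
Qed.

Lemma Delta11_lconst (T : topologicalType) U (h : T -> U) (P : U -> Prop) :
  lconst h -> Delta11 [set t | P (h t)].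
Proof.
move=> lh; split; first by apply: Sigma11_closed; exact: lconst_closed.
apply: Sigma11_closed; exact: (@lconst_closed _ _ h (fun u => ~ P u)).
Qed.

(** * Borel sets and Borel functions *)

Lemma sigma_algebra_borel (T : topologicalType) : sigma_algebra setT (@borel_set T).
Proof. exact: smallest_sigma_algebra. Qed.

Lemma borel_open (T : topologicalType) (A : set T) : open A -> borel_set A.
Proof. exact: sub_sigma_algebra. Qed.

Lemma borel_closed (T : topologicalType) (A : set T) : closed A -> borel_set A.
Proof.
move=> cA; rewrite -(setCK A).
exact: (sa_not (@sigma_algebra_borel T) (borel_open (closed_openC cA))).
Qed.

Lemma borel_lconst (T : topologicalType) U (h : T -> U) (P : U -> Prop) :
  lconst h -> borel_set [set t | P (h t)].
Proof. by move=> lh; apply: borel_open; exact: lconst_open. Qed.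

Lemma borel_functionP (T U : topologicalType) (f : T -> U) :
  (forall A, open A -> borel_set (f @^-1` A)) -> borel_function f.
Proof.
move=> h; suff: @borel_set U `<=` [set A | borel_set (f @^-1` A)] by [].
apply: smallest_sub => //; split.
- by rewrite /= preimage_set0; case: (@sigma_algebra_borel T).
- by move=> A /= hA; rewrite setTD preimage_setC -setTD; case: (@sigma_algebra_borel T) => _ + _; exact.
- by move=> A /= hA; rewrite preimage_bigcup; case: (@sigma_algebra_borel T) => _ _; exact.
Qed.

Lemma borel_continuous (T U : topologicalType) (f : T -> U) :
  continuous f -> borel_function f.
Proof. by move=> cf; apply: borel_functionP => A oA; apply: borel_open; exact: open_preimage. Qed.

Lemma borel_comp (S T U : topologicalType) (f : S -> T) (g : T -> U) :
  borel_function f -> borel_function g -> borel_function (fun x => g (f x)).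
Proof. by move=> bf bg B /bg /bf. Qed.

(* Every open subset of the Baire space is a countable union of cylinders. *)
Lemma borel_function_baire (T : topologicalType) (f : T -> baire) :
  (forall n m, borel_set [set t | f t n = m]) -> borel_function f.
Proof.
move=> h; apply: borel_functionP => A oA.
have sB := @sigma_algebra_borel T.
have cyl (s : seq nat) : borel_set [set t | mkseq (f t) (size s) = s].
  apply: (@sa_ext T (@borel_set T) (fun t => forall n : nat, (n < size s)%N -> f t n = nth 0%N s n)).
    move=> t; split=> [ft|ft n ns]; last by rewrite -[in RHS]ft nth_mkseq.
    apply: (@eq_from_nth _ 0%N); rewrite size_mkseq // => n ns.
    by rewrite nth_mkseq // ft.
  apply: (sa_forall sB) => n; apply: (sa_imp sB) => //.
  exact: (sa_const sB).
apply: (@sa_ext T (@borel_set T) (fun t => exists s : seq nat,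
   mkseq (f t) (size s) = s /\ (forall y : baire, mkseq y (size s) = s -> A y))).
  move=> t; split=> [[s [<- h']]|Aft].
    by apply: h'; rewrite size_mkseq.
  have /nbhs_baireP[n hn] : nbhs (f t) A by move: oA; rewrite openE => /(_ _ Aft).
  by exists (mkseq (f t) n); rewrite size_mkseq.
apply: (sa_exists sB) => s; apply: (sa_and sB) => //.
exact: (sa_const sB).
Qed.

Lemma borel_if (T U : topologicalType) (P : T -> Prop) (f g : T -> U) :
  borel_set [set t | P t] -> borel_function f -> borel_function g ->
  borel_function (fun t => if pselect (P t) then f t else g t).
Proof.
move=> bP bf bg B bB; have sB := @sigma_algebra_borel T.
apply: (@sa_ext T (@borel_set T) (fun t => (P t -> B (f t)) /\ (~ P t -> B (g t)))).
  by move=> t; case: pselect => Pt /=; split=> [[]|h]; try split; auto.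
apply: (sa_and sB); apply: (sa_imp sB) => //; [exact: bf|exact: (sa_not sB)|exact: bg].
Qed.

(** * Polish spaces *)

Section Polish.
Local Open Scope ring_scope.

Lemma metric_ge0 (R : realType) T (d : T -> T -> R) x y : is_metric d -> 0 <= d x y.
Proof.
move=> [d0 sym tri]; have := tri x y x; rewrite (sym y x) (d0 x x).2 //; lra.
Qed.

Lemma natSinv_gt0 (R : realType) n : 0 < n.+1%:R^-1 :> R.
Proof. by rewrite invr_gt0. Qed.

Lemma natSinv_lt (R : realType) n m : (n.+1%:R^-1 < m.+1%:R^-1 :> R) = (m < n)%N.
Proof. by rewrite ltf_pV2 ?posrE // ltr_nat ltnS. Qed.

Lemma natSinv_le (R : realType) n m : (n.+1%:R^-1 <= m.+1%:R^-1 :> R) = (m <= n)%N.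
Proof. by rewrite lef_pV2 ?posrE // ler_nat. Qed.

Lemma natSinv_small (R : realType) (e : R) : 0 < e -> exists n, n.+1%:R^-1 < e.
Proof. by move=> /ltr_add_invr[n]; rewrite add0r; exists n. Qed.

Definition baire_dist (R : realType) (x y : baire) : R :=
  if pselect (exists n, x n != y n) is left h then (ex_minn h).+1%:R^-1 else 0.

Lemma baire_distE R (x y : baire) : x = y /\ baire_dist R x y = 0 \/
  exists n, [/\ x n <> y n, forall m, (m < n)%N -> x m = y m
    & baire_dist R x y = n.+1%:R^-1].
Proof.
rewrite /baire_dist; case: pselect => [h|h]; last first.
  left; split=> //; apply/funext => n; apply/eqP; apply: contra_notT h => xy.
  by exists n.
case: ex_minnP => n xyn minn; right; exists n; split=> // [|m mn]; first exact/eqP.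
by apply/eqP; apply: contraTT mn => xym; rewrite -leqNgt; exact: minn.
Qed.

Lemma baire_dist_ge R (x y : baire) n : x n <> y n -> n.+1%:R^-1 <= baire_dist R x y.
Proof.
move=> xyn; have [[xy _]|[m [xym le_m ->]]] := baire_distE R x y.
  by case: xyn; rewrite xy.
by rewrite natSinv_le leqNgt; apply/negP => /le_m.
Qed.

Lemma baire_dist_lt R (x y : baire) n :
  baire_dist R x y < n.+1%:R^-1 <-> forall m, (m <= n)%N -> x m = y m.
Proof.
split=> [lt_n m mn|h].
  apply: contrapT => /(baire_dist_ge R) le_m.
  by have := le_lt_trans le_m lt_n; rewrite natSinv_lt ltnNge mn.
have [[_ ->]|[m [xym _ ->]]] := baire_distE R x y; first exact: natSinv_gt0.
by rewrite natSinv_lt ltnNge; apply/negP => /h.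
Qed.

Lemma baire_dist_metric R : is_metric (baire_dist R).
Proof.
have ge0 x y : 0 <= baire_dist R x y.
  by have [[_ ->]|[n [_ _ ->]]] := baire_distE R x y => //; exact/ltW/natSinv_gt0.
split=> [x y|x y|x y z].
- split=> [|->].
    have [[->]|[n [_ _ ->]] /eqP] // := baire_distE R x y.
    by rewrite invr_eq0 pnatr_eq0.
  by have [[_ ->]|[n []]] := baire_distE R y y.
- have le u v : baire_dist R u v <= baire_dist R v u.
    have [[_ ->]|[n [uvn _ ->]]] := baire_distE R u v; first exact: ge0.
    by apply: baire_dist_ge => /esym.
  by apply/eqP; rewrite eq_le !le.
(* At the first place where [x] and [z] differ, [y] differs from one of them, so one of the two
   summands is already large enough. *)
- have [[_ ->]|[n [xzn _ ->]]] := baire_distE R x z; first by rewrite addr_ge0.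
  have [xyn|xyn] := pselect (x n = y n).
    by rewrite -[leLHS]add0r lerD // baire_dist_ge // -xyn.
  by rewrite -[leLHS]addr0 lerD // baire_dist_ge.
Qed.

Lemma eq_mkseqP (x y : nat -> nat) n :
  mkseq x n = mkseq y n <-> forall m, (m < n)%N -> x m = y m.
Proof.
split=> [h m mn|h].
  by have := congr1 (fun s => nth 0%N s m) h; rewrite !nth_mkseq.
by apply: (@eq_from_nth _ 0%N); rewrite !size_mkseq // => m mn; rewrite !nth_mkseq // h.
Qed.

Lemma polish_baire (R : realType) : polish R baire.
Proof.
split.
  exists (range (fun s : seq nat => nth 0%N s : baire)).
    exact: card_le_trans (card_image_le _ _) (countableP _).
  move=> O [x Ox]; rewrite openE => /(_ _ Ox) /nbhs_baireP[n h].
  exists (nth 0%N (mkseq x n)); split; last by exists (mkseq x n).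
  by apply: h; apply/eq_mkseqP => m mn; rewrite nth_mkseq.
exists (baire_dist R); split; first exact: baire_dist_metric.
  move=> x A; split=> [/nbhs_baireP[n h]|[e e0 h]].
    exists n.+1%:R^-1; first exact: natSinv_gt0.
    move=> y /= /baire_dist_lt xy; apply: h; apply/eq_mkseqP => m mn.
    by rewrite xy // ltnW.
  have [n ne] := natSinv_small e0; apply/nbhs_baireP; exists n.+1 => y /eq_mkseqP xy.
  by apply: h => /=; apply: lt_trans ne; apply/baire_dist_lt => m mn; rewrite xy.
move=> u cu; have /choice[N NP] : forall k, exists N, forall m n, (N <= m)%N -> (N <= n)%N ->
    forall i, (i <= k)%N -> u m i = u n i.
  move=> k; have [N h] := cu _ (natSinv_gt0 R k); exists N => m n mN nN.
  by apply/baire_dist_lt; exact: h.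
(* The stages [N k] need not increase with [k], so coordinates are compared through a stage beyond
   both. *)
exists (fun k => u (N k) k) => A /nbhs_baireP[n h]; exists (N n) => // m /= mN.
apply: h; apply/eq_mkseqP => i /ltnW ni.
rewrite (NP n m (maxn m (N i)) mN _ i ni) ?(leq_trans mN) ?leq_maxl //.
by rewrite (NP i _ (N i)) // leq_maxr.
Qed.

Lemma polish_prod (R : realType) (T U : topologicalType) :
  polish R T -> polish R U -> polish R (T * U)%type.
Proof.
move=> [[S cS dS] [d [md nd cd]]] [[S' cS' dS'] [d' [md' nd' cd']]]; split.
  exists (S `*` S'); first exact: countableX.
  move=> O [[x y] Oxy] oO; have : nbhs (x, y) O by move: oO; rewrite openE; exact.
  move=> [[P Q] /= [xP yQ] PQO].
  have [p [pP pS]] : P° `&` S !=set0.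
    by apply: dS; [exists x|exact: open_interior].
  have [q [qQ qS]] : Q° `&` S' !=set0.
    by apply: dS'; [exists y|exact: open_interior].
  exists (p, q); split; last by split.
  by apply: PQO; split=> /=; [exact: nbhs_singleton pP|exact: nbhs_singleton qQ].
have [d0 ds dt] := md; have [d0' ds' dt'] := md'.
exists (fun p q => Num.max (d p.1 q.1) (d' p.2 q.2)); split.
- split=> [[x y] [x' y']|[x y] [x' y']|[x y] [x' y'] [x'' y'']] /=.
  + split=> [h|[-> ->]]; last by rewrite (d0 _ _).2 // (d0' _ _).2 // maxxx.
    have h1 : d x x' <= 0 by rewrite -h le_max lexx.
    have h2 : d' y y' <= 0 by rewrite -h le_max lexx orbT.
    have := metric_ge0 x x' md; have := metric_ge0 y y' md' => g2 g1.
    by congr pair; [apply/d0|apply/d0']; apply/eqP; rewrite eq_le ?h1 ?h2 ?g1 ?g2.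
  + by rewrite ds ds'.
  + rewrite ge_max; apply/andP; split.
      by apply: le_trans (dt x x' x'') _; apply: lerD; rewrite le_max lexx.
    by apply: le_trans (dt' y y' y'') _; apply: lerD; rewrite le_max lexx orbT.
- move=> [x y] A; split=> [[[P Q] /= [/nd[e e0 eP] /nd'[e' e0' eQ]] PQA]|[e e0 eA]].
    exists (Num.min e e'); first by rewrite lt_min e0.
    move=> [x' y'] /=; rewrite gt_max !lt_min => /andP[/andP[xe _] /andP[_ ye]].
    by apply: PQA; split; [exact: eP|exact: eQ].
  exists ([set x' | d x x' < e], [set y' | d' y y' < e]).
    by split; [apply/nd|apply/nd']; exists e.
  by move=> [x' y'] /= [xe ye]; apply: eA; rewrite /= gt_max xe.
- move=> u cu; have [|l ul] := cd (fun n => (u n).1).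
    move=> e /cu[N h]; exists N => m n mN nN.
    by have := h m n mN nN; rewrite gt_max => /andP[].
  have [|l' ul'] := cd' (fun n => (u n).2).
    move=> e /cu[N h]; exists N => m n mN nN.
    by have := h m n mN nN; rewrite gt_max => /andP[].
  exists (l, l'); have -> : u = fun n => ((u n).1, (u n).2).
    by apply/funext => n; case: (u n).
  exact: cvg_pair.
Qed.

Lemma metric_ball_open (R : realType) (T : topologicalType) (d : T -> T -> R) p e :
  is_metric d ->
  (forall (x : T) (A : set T), nbhs x A <-> exists2 e : R, 0 < e & [set y | d x y < e] `<=` A) ->
  open [set z | d p z < e].
Proof.
move=> [_ _ tri] nd; rewrite openE => z /= pz; apply/nd.
exists (e - d p z); first by rewrite subr_gt0.
move=> y /= zy; have := tri p z y; lra.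
Qed.

Lemma polish_base (R : realType) (T : topologicalType) : polish R T ->
  exists U : nat -> set T, (forall k, open (U k)) /\
    forall (x : T) (A : set T), nbhs x A -> exists2 k, U k x & U k `<=` A.
Proof.
move=> [[S /countable_injP[f finj] dS] [d [md nd _]]]; have [d0 ds tri] := md.
(* The index codes a center and a radius. By injectivity of [f] the union has at most one member;
   writing it as a union also covers numbers [a] which code no point of [S]. *)
exists (fun k => if (unpickle k : option (nat * nat)) is Some (a, j) then
  \bigcup_(p in [set p | S p /\ f p = a]) [set z | d p z < j.+1%:R^-1] else set0).
split=> [k|x A /nd[e e0 eA]].
  case: (unpickle k : option (nat * nat)) => [[a j]|]; last exact: open0.
  by apply: bigcup_open => p _; exact: metric_ball_open.
have [j je] : exists j, j.+1%:R^-1 < e / 2 by apply: natSinv_small; lra.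
have [p [/= xp Sp]] : [set z | d x z < j.+1%:R^-1] `&` S !=set0.
  apply: dS; last exact: metric_ball_open.
  by exists x; rewrite /= ((d0 x x).2 erefl) natSinv_gt0.
exists (pickle (f p, j)); rewrite pickleK; first by exists p => //=; rewrite ds.
move=> z [p' [Sp' /finj]]; rewrite !inE => -> //; rewrite /mkset /= => pz.
apply: eA => /=; move: je xp pz (tri x p z); move: (j.+1%:R^-1) => c; lra.
Qed.

(** A sequence names the limit of a rapidly converging sequence of dense points. Bad steps are
    skipped, so that every sequence is a name, and [sigma] finds a name by least indices. *)
Lemma polish_coding (R : realType) (Y : topologicalType) (y0 : Y) : polish R Y ->
  exists (pi : baire -> Y) (sigma : Y -> baire),
    [/\ continuous pi, borel_function sigma & forall y, pi (sigma y) = y].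
Proof.
move=> [[S /countable_injP[f finj] dS] [d [md nd cd]]]; have [d0 ds tri] := md.
have ge0 x y := metric_ge0 x y md.
have [q qdense] : exists q : nat -> Y, forall y e, 0 < e -> exists n, d (q n) y < e.
  have /choice[q qP] : forall n, exists p, forall p', S p' -> f p' = n -> p = p'.
    move=> n; have [[p [Sp fp]]|h] := pselect (exists p, S p /\ f p = n).
      by exists p => p' Sp' fp'; apply: finj; rewrite ?inE // fp.
    by exists y0 => p' Sp' fp'; case: h; exists p'.
  exists q => y e e0.
  have [p [/= yp Sp]] : [set z | d y z < e] `&` S !=set0.
    apply: dS; last exact: metric_ball_open.
    by exists y; rewrite /= ((d0 y y).2 erefl).
  by exists (f p); rewrite ds (qP _ _ Sp).
pose dl (k : nat) : R := 2^-1 ^+ k.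
have dl_gt0 k : 0 < dl k by rewrite exprn_gt0 // invr_gt0.
have dlS k : dl k = 2 * dl k.+1 by rewrite /dl exprS mulrA divff ?mul1r.
have dl_small e : 0 < e -> exists k, dl k < e.
  move=> /natSinv_small[k ke]; exists k; apply: le_lt_trans ke.
  rewrite /dl exprVn lef_pV2 ?posrE ?exprn_gt0 // -natrX ler_nat; exact: ltn_expl.
(* [a v] follows [v] as long as the [k]-th step is shorter than [dl k], and otherwise stays where it
   is. *)
pose a := fix a (v : nat -> nat) k := if k is k'.+1 then
  if d (q (a v k')) (q (v k)) < dl k' then v k else a v k' else v 0%N.
have a_step v k : d (q (a v k)) (q (a v k.+1)) < dl k.
  by rewrite /=; case: ifP => // _; rewrite ((d0 _ _).2 erefl).
have a_near v k m : d (q (a v k)) (q (a v (k + m)%N)) <= 2 * dl k - 2 * dl (k + m)%N.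
  elim: m => [|m ih]; first by rewrite addn0 ((d0 _ _).2 erefl) subrr.
  have := tri (q (a v k)) (q (a v (k + m)%N)) (q (a v (k + m).+1)).
  have := a_step v (k + m)%N; have := dlS (k + m)%N; rewrite addnS; lra.
have /choice[pi piP] : forall v : baire, exists l : Y, (fun n => q (a v n)) @ \oo --> l.
  move=> v; apply: cd => e e0.
  have [k ke] : exists k, dl k < e / 4 by apply: dl_small; lra.
  exists k => m n km kn; rewrite -(subnKC km) -(subnKC kn).
  have := a_near v k (m - k)%N; have := a_near v k (n - k)%N.
  have := tri (q (a v (k + (m - k))%N)) (q (a v k)) (q (a v (k + (n - k))%N)).
  rewrite (ds _ (q (a v k))).
  have := dl_gt0 (k + (m - k))%N; have := dl_gt0 (k + (n - k))%N; lra.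
have pi_near v k : d (q (a v k)) (pi v) < 3 * dl k.
  have : nbhs (pi v) [set z | d (pi v) z < dl k].
    by apply/nd; exists (dl k).
  move=> /(piP v)[N _ h]; have := h (k + N)%N (leq_addl _ _); rewrite /= => near_N.
  have := a_near v k N; have := tri (q (a v k)) (q (a v (k + N)%N)) (pi v).
  rewrite (ds (q (a v (k + N)%N))); have := dl_gt0 (k + N)%N; lra.
(* With radius [dl k.+1], two successive points are closer than [dl k.+1 + dl k.+2], which is less
   than [dl k]; no step of [sigma y] is skipped. *)
have ex_near y k : exists n, d (q n) y < dl k.+1 by exact: qdense.
pose sigma (y : Y) : baire := fun k => ex_minn (ex_near y k).
exists pi, sigma; split.
- move=> v A /nd[e e0 eA]; have [k ke] : exists k, dl k < e / 6 by apply: dl_small; lra.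
  suff : nbhs v (pi @^-1` A) by [].
  apply/nbhs_baireP; exists k.+1 => v' /eq_mkseqP vv'.
  have av j : (j <= k)%N -> a v' j = a v j.
    by elim: j => [|j ih] jk /=; rewrite vv' ?ih // ltnW.
  apply: eA => /=; have := pi_near v k; have := pi_near v' k; rewrite av //.
  have := tri (pi v) (q (a v k)) (pi v'); rewrite (ds (pi v) (q _)); lra.
- have sB := @sigma_algebra_borel Y; apply: borel_function_baire => k n.
  apply: (@sa_ext Y (@borel_set Y) (fun y => d (q n) y < dl k.+1 /\
      forall m : nat, d (q m) y < dl k.+1 -> (n <= m)%N)).
    move=> y; rewrite /sigma; case: ex_minnP => m md' mmin; split=> [[dn nmin]|<-//].
    by apply/eqP; rewrite eqn_leq nmin // mmin.
  have bb m : borel_set [set y | d (q m) y < dl k.+1].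
    by apply: borel_open; exact: metric_ball_open.
  apply: (sa_and sB) => //; apply: (sa_forall sB) => m; apply: (sa_imp sB) => //.
  exact: (sa_const sB).
- move=> y; have sn k : d (q (sigma y k)) y < dl k.+1 by rewrite /sigma; case: ex_minnP.
  have ak k : a (sigma y) k = sigma y k.
    elim: k => // k ih; rewrite [LHS]/= ih ifT //.
    have := tri (q (sigma y k)) y (q (sigma y k.+1)); rewrite (ds y).
    have := sn k; have := sn k.+1; have := dlS k; have := dlS k.+1; have := dl_gt0 k.+2; lra.
  apply/d0/eqP; rewrite eq_le ge0 andbT leNgt; apply/negP => pos.
  (* The distance is less than [3 * dl k + dl k.+1], hence less than [4 * dl k]. *)
  have [k ke] := dl_small _ (divr_gt0 pos (ltr0n _ 4)).
  have := pi_near (sigma y) k; rewrite ak; have := sn k; have := dlS k.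
  have := tri (pi (sigma y)) (q (sigma y k)) y; rewrite (ds (pi (sigma y)) (q _)).
  have := dl_gt0 k; lra.
Qed.

End Polish.

(** * A universal analytic set *)

Lemma take_mkseq T (x : nat -> T) m n : (m <= n)%N -> take m (mkseq x n) = mkseq x m.
Proof. by move=> mn; rewrite /mkseq -map_take take_iota (minn_idPl mn). Qed.

Lemma lconst_app (T : topologicalType) (x : T -> nat -> nat) (k : T -> nat) :
  (forall n, lconst (fun t => x t n)) -> lconst k -> lconst (fun t => x t (k t)).
Proof.
by move=> lx lk t; have := lk t; have := lx (k t) t; apply: filterS2 => t' h1 ->.
Qed.

Lemma lconst_baire (T : topologicalType) (f : T -> baire) n :
  continuous f -> lconst (fun t => f t n).
Proof. by move=> cf; exact: (lconst_cont cf (@lconst_coord n)). Qed.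

Definition meets (F : set (baire * baire)) (s t : seq nat) : Prop :=
  exists x y : baire, [/\ F (x, y), mkseq x (size s) = s & mkseq y (size t) = t].

(** A closed set is the set of branches of its tree of pairs of finite sequences. *)
Lemma meets_closed (F : set (baire * baire)) (x y : baire) : closed F ->
  F (x, y) <-> forall n, meets F (mkseq x n) (mkseq y n).
Proof.
move=> cF; split=> [Fxy n|h]; first by exists x, y; rewrite !size_mkseq.
apply: contrapT => nF; have : nbhs (x, y) (~` F).
  by move: cF; rewrite -openC openE; exact.
move=> [[P Q] /= [/nbhs_baireP[n hP] /nbhs_baireP[m hQ]] PQF].
have [x' [y' []]] := h (maxn n m); rewrite !size_mkseq => Fxy' xx' yy'.
have restr (u v : baire) k l : (k <= l)%N -> mkseq u l = mkseq v l -> mkseq u k = mkseq v k.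
  by move=> kl uv; rewrite -(take_mkseq u kl) uv take_mkseq.
apply: (PQF (x', y')) Fxy'; split => /=.
  by apply: hP; apply: restr xx'; rewrite leq_maxl.
by apply: hQ; apply: restr yy'; rewrite leq_maxr.
Qed.

(** The zeros of [c] mark a set of pairs of finite sequences; [x] is in the coded set iff some [b]
    forms a branch of it together with [x]. *)
Definition universal (c x : baire) : Prop :=
  exists b : baire, forall n, c (pickle (mkseq x n, mkseq b n)) = 0%N.

Lemma universalP (A : set baire) : Sigma11 A -> exists c, forall x, A x <-> universal c x.
Proof.
move=> /Sigma11P[F cF h].
exists (fun m => if (unpickle m : option (seq nat * seq nat)) is Some (s, t)
  then (~~ `[< meets F s t >] : nat) else 1%N).
move=> x; rewrite h /universal.
split=> -[b hb]; exists b.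
  move=> n; rewrite pickleK; move/meets_closed: hb => /(_ cF n) hb.
  by rewrite asboolT.
apply/meets_closed => // n; have := hb n; rewrite pickleK.
by case: asboolP.
Qed.

Definition universal_set : set baire := [set a | universal (slice 0 a) (slice 1 a)].

Lemma Sigma11_universal_set : Sigma11 universal_set.
Proof.
apply: (@Sigma11_project _ [set p : baire * baire | forall n,
  slice 0 p.1 (pickle (mkseq (slice 1 p.1) n, mkseq p.2 n)) = 0%N]).
apply: Sigma11_forall => n; apply: Sigma11_closed.
have c1 := @continuous_fst baire baire; have c2 := @continuous_snd baire baire.
have c3 k := continuous_compose c1 (@continuous_slice k).
apply: (@lconst_closed _ _ (fun p : baire * baire =>
  slice 0 p.1 (pickle (mkseq (slice 1 p.1) n, mkseq p.2 n))) (fun m => m = 0%N)).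
apply: (lconst_app (x := fun p : baire * baire => slice 0 p.1)) => [k|]; first exact: lconst_baire.
apply: (lconst_comp pickle); apply: lconst_pair.
  by apply: (lconst_mkseq_fun (f := fun p : baire * baire => slice 1 p.1)) => k; exact: lconst_baire.
by apply: (lconst_mkseq_fun (f := fun p : baire * baire => p.2)) => k; exact: lconst_baire.
Qed.

(** * Borel codes *)

(* Nodes with label 0 compute the NOR of their children, a node with label k + 1 is a leaf
   and stands for the k-th subbasic clopen set. *)
Definition leaf (k : nat) (t : nat -> nat) : bool :=
  if (unpickle k : option (nat * nat)) is Some (i, m) then t i == m else false.

Definition code_eval (q t : nat -> nat) (e : seq nat -> bool) : Prop :=
  forall u, if q (pickle u) is k.+1 then e u = leaf k t
            else e u <-> forall n, ~~ e (rcons u n).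

Definition code_child (q : nat -> nat) (c u : seq nat) : Prop :=
  q (pickle u) = 0%N /\ exists n, c = rcons u n.

Definition code_wf (q : nat -> nat) : Prop := well_founded (code_child q).

Definition code_ill (q : nat -> nat) : Prop :=
  exists u (b : baire), forall n, q (pickle (u ++ mkseq b n)) = 0%N.

Lemma code_illP q : code_ill q <-> ~ code_wf q.
Proof.
split=> [[u [b h]] wf|].
  have := wf (u ++ mkseq b 0).
  apply: (@path_not_acc _ _ (fun n => u ++ mkseq b n)) => n; split; first exact: h.
  by exists (b n); rewrite mkseqS rcons_cat.
move=> /existsNP[u nu]; have [g g0 gP] := not_acc_path nu.
have [sz [h gE]] := rcons_path_limit 0%N (fun n => (gP n).2).
exists u, (fun k => h (size u + k)%N) => n.
suff <- : g n = u ++ mkseq (fun k => h (size u + k)%N) n by exact: (gP n).1.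
rewrite gE sz g0 /mkseq iotaD map_cat; congr (_ ++ _).
  by rewrite -[RHS]g0 [in RHS]gE g0.
by rewrite add0n -[in LHS](addn0 (size u)) iotaDl -map_comp.
Qed.

(** Evaluation by recursion on the code, as a relation: single-valued on every code, and total on
    well-founded ones. *)
Inductive code_value (q t : nat -> nat) : seq nat -> bool -> Prop :=
| CodeLeaf u k of q (pickle u) = k.+1 : code_value q t u (leaf k t)
| CodeTrue u of q (pickle u) = 0%N & (forall n, code_value q t (rcons u n) false) :
    code_value q t u true
| CodeFalse u n of q (pickle u) = 0%N & code_value q t (rcons u n) true :
    code_value q t u false.

Lemma code_value_fun q t u b b' : code_value q t u b -> code_value q t u b' -> b = b'.
Proof.
move=> h; elim: h b' => {u b} [u k qu|u qu _ ih|u n qu _ ih] b' h'.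
- by case: h' qu => [v k' ->|v -> _|v m -> _] // [->].
- by case: h' qu ih => [v k ->|v _ _|v n _ vt _ ih] //; have := ih _ _ vt.
- by case: h' qu ih => [v k ->|v _ vf _ ih|v m _ _] //; have := ih _ (vf n).
Qed.

Lemma code_eval_exists q t : code_wf q -> exists e, code_eval q t e.
Proof.
move=> wf; have /choice[e eP] : forall u, exists b, code_value q t u b.
  move=> u; elim: (wf u) => {}u _ ih.
  case qu : (q (pickle u)) => [|k]; last by exists (leaf k t); exact: CodeLeaf.
  have [[n ut]|nt] := pselect (exists n, code_value q t (rcons u n) true).
    by exists false; exact: CodeFalse ut.
  exists true; apply: CodeTrue => // n.
  have [|[] //] := ih (rcons u n); first by split=> //; exists n.
  by move=> ut; case: nt; exists n.
exists e => u; case qu : (q (pickle u)) => [|k]; last first.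
  exact: code_value_fun (eP u) (CodeLeaf t qu).
split=> [eu n|h].
  apply/negP => en; have := CodeFalse qu (n := n) (t := t); have := eP (rcons u n).
  rewrite en => h /(_ h) /(code_value_fun (eP u)); by rewrite eu.
suff /(code_value_fun (eP u)) -> : code_value q t u true by [].
by apply: CodeTrue => // n; have := eP (rcons u n); rewrite (negPf (h n)).
Qed.

(** The default label 0 makes the root a NOR node, with the code [q n] as its [n]-th subtree. *)
Definition nor_code (q : nat -> baire) : baire := fun m =>
  if (unpickle m : option (seq nat)) is Some (n :: u) then q n (pickle u) else 0%N.

Definition coded (A : set baire) : Prop :=
  exists q : baire, code_wf q /\ forall t e, code_eval q t e -> (e [::] <-> A t).

Lemma nor_code_wf q : (forall n, code_wf (q n)) -> code_wf (nor_code q).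
Proof.
move=> wf; have acc n u : Acc (code_child (nor_code q)) (n :: u).
  elim: (wf n u) => {}u _ ih; constructor=> _ [q0 [m ->]]; apply: ih; split; last by exists m.
  by move: q0; rewrite /nor_code pickleK.
by move=> [|n u]; [constructor=> _ [_ [n ->]]; exact: acc|exact: acc].
Qed.

Lemma nor_code_eval q t e : code_eval (nor_code q) t e ->
  (e [::] <-> forall n, ~~ e [:: n]) /\ forall n, code_eval (q n) t (fun u => e (n :: u)).
Proof.
move=> h; split; first exact: (h [::]).
by move=> n u; have := h (n :: u); rewrite /nor_code pickleK.
Qed.

Lemma coded_nor (A : nat -> set baire) : (forall n, coded (A n)) ->
  coded [set t | forall n, ~ A n t].
Proof.
move=> /choice[q qP]; exists (nor_code q); split.
  by apply: nor_code_wf => n; exact: (qP n).1.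
move=> t e /nor_code_eval[-> h]; split=> he n; have := (qP n).2 _ _ (h n); have := he n.
  by move=> /negP ne [_ /[apply]].
by move=> nA [ + _]; move=> eA; apply/negP => /eA.
Qed.

Lemma coded_ext (A B : set baire) : (forall t, A t <-> B t) -> coded A -> coded B.
Proof. by move=> AB; congr coded; apply/seteqP; split=> t /AB. Qed.

Lemma coded_leaf i m : coded [set t | t i = m].
Proof.
exists (fun=> (pickle (i, m)).+1); split; first by move=> u; constructor=> v [].
by move=> t e /(_ [::]) ->; rewrite /leaf pickleK; split=> /eqP.
Qed.

(** NOR generates the operations: for a constant family it is the complement, and its complement is
    the union. *)
Lemma sigma_algebra_coded : sigma_algebra setT coded.
Proof.
have codedC A : coded A -> coded (~` A).
  move=> cA; have := coded_nor (fun _ : nat => cA); apply: coded_ext => t.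
  by split=> [h|h _]; [exact: (h 0%N)|exact: h].
have codedU (A : nat -> set baire) : (forall n, coded (A n)) -> coded (\bigcup_n A n).
  move=> /coded_nor/codedC; apply: coded_ext => t; split=> [|[n _ An] /(_ n)] //.
  by move=> /existsNP[n /contrapT An]; exists n.
split=> [|A cA|//]; last by rewrite setTD; exact: codedC.
have -> : set0 = ~` (\bigcup_m [set t : baire | t 0%N = m]).
  apply/seteqP; split=> // t; apply; by exists (t 0%N).
by apply: codedC; apply: codedU => m; exact: coded_leaf.
Qed.

Lemma borel_coded (B : set baire) : borel_set B -> coded B.
Proof.
suff: @borel_set baire `<=` coded by exact.
have sG := sigma_algebra_coded.
apply: smallest_sub => // A; rewrite openE => oA.
apply: (@sa_ext baire coded (fun t => exists s : seq nat,
    (forall i : nat, (i < size s)%N -> t i = nth 0%N s i) /\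
    forall y : baire, mkseq y (size s) = s -> A y)).
  move=> t; split=> [[s [ts]]|/oA /nbhs_baireP[n h]].
    apply; apply: (@eq_from_nth _ 0%N); rewrite size_mkseq // => i si.
    by rewrite nth_mkseq // ts.
  exists (mkseq t n); rewrite size_mkseq; split=> // i si; by rewrite nth_mkseq.
apply: (sa_exists sG) => s; apply: (sa_and sG); last exact: (sa_const sG).
apply: (sa_forall sG) => i; apply: (sa_imp sG); first exact: (sa_const sG).
exact: coded_leaf.
Qed.

(* The function with values in the Baire space which is coded by q: the child
   with index <n, m> of the root decides whether the n-th coordinate is m. *)
Definition code_output (e : seq nat -> bool) (v : nat -> nat) : Prop :=
  forall n, (e [:: pickle (n, v n)] /\ forall m, (m < v n)%N -> ~~ e [:: pickle (n, m)])
    \/ (v n = 0%N /\ forall m : nat, ~~ e [:: pickle (n, m)]).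

(** Least values and the default 0 give every evaluation an output, even that of a code which comes
    from no function. The diagonalization ranges over such codes as well. *)
Lemma code_output_exists e : exists v : baire, code_output e v.
Proof.
have /choice[v vP] : forall n : nat, exists v : nat,
    (e [:: pickle (n, v)] /\ forall m, (m < v)%N -> ~~ e [:: pickle (n, m)])
    \/ (v = 0%N /\ forall m : nat, ~~ e [:: pickle (n, m)]); last by exists v.
move=> n.
have [h|h] := pselect (exists m : nat, e [:: pickle (n, m)]).
  exists (ex_minn h); case: ex_minnP => m em mmin; left; split=> // k km.
  by apply/negP => /mmin; rewrite leqNgt km.
by exists 0%N; right; split=> // m; apply/negP => em; apply: h; exists m.
Qed.

Lemma borel_function_coded (f : baire -> baire) : borel_function f ->
  exists q : baire, code_wf q /\
    forall t e v, code_eval q t e -> code_output e v -> v = f t.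
Proof.
move=> bf; have /choice[q qP] : forall k, exists q : baire, code_wf q /\ forall t e,
    code_eval q t e -> (e [::] <-> forall n m, (unpickle k : option (nat * nat)) = Some (n, m) -> f t n = m).
  move=> k; case E : (unpickle k : option (nat * nat)) => [[n m]|].
    have bA : borel_set [set t | f t n = m].
      by apply: (bf [set x : baire | x n = m]); exact: (@borel_lconst baire nat (fun x => x n) (fun k => k = m) (@lconst_coord n)).
    have [q [wf qP]] := borel_coded bA; exists q; split=> // t e /qP ->.
    by split=> [ftn _ _ [<- <-]|] //; exact.
  have bT : borel_set [set: baire] by apply: borel_open; exact: openT.
  by have [q [wf qP]] := borel_coded bT; exists q; split=> // t e /qP ->.
exists (nor_code q); split; first by apply: nor_code_wf => n; exact: (qP n).1.
move=> t e v /nor_code_eval[_ he] hv.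
have em n m : e [:: pickle (n, m)] <-> f t n = m.
  rewrite ((qP _).2 _ _ (he (pickle (n, m)))) pickleK.
  by split=> [|ftn _ _ [<- <-]] //; exact.
apply/funext => n; have [[/em -> //]|[_ /(_ (f t n)) /negP]] := hv n.
by case; apply/em.
Qed.

(** * A Sigma12-hard set of trees *)

Definition tree_of (s : nat -> nat) (u : seq nat) : bool := s (pickle u) == 0%N.

Definition branch_set : set baire := [set s | has_wf_branch (tree_of s)].

Section Hardness.
Context {Z : topologicalType} (U : nat -> set Z) (F : set ((Z * baire) * baire)).
Context (U_open : forall k, open (U k)).
Context (U_base : forall (x : Z) (A : set Z), nbhs x A -> exists2 k, U k x & U k `<=` A).
Context (F_closed : closed F).

Let avoids k (u t : seq nat) : Prop := forall (z : Z) (x b : baire), U k z ->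
  mkseq x (size u) = u -> mkseq b (size t) = t -> ~ F ((z, x), b).

(* t belongs to the tree of attempts to find b with F ((z, x), b), where x extends u. *)
Let in_tree (z : Z) (u t : seq nat) : Prop := forall k n : nat,
  (k <= size t)%N -> (n <= size t)%N -> U k z -> ~ avoids k (take n u) (take n t).

Let child (z : Z) (x : nat -> nat) (i j : nat) : Prop := exists (t : seq nat) (a : nat),
  [/\ i = pickle (rcons t a), j = pickle t & in_tree z (mkseq x (size t).+1) (rcons t a)].

Let avoids_exists z x b : ~ F ((z, x), b) ->
  exists k n, U k z /\ forall m, (n <= m)%N -> avoids k (mkseq x m) (mkseq b m).
Proof.
move=> nF; have : nbhs ((z, x), b) (~` F).
  by move: F_closed; rewrite -openC openE; exact.
move=> [[P Q] /= [[[P1 P2] /= [/U_base[k Uz UP] /nbhs_baireP[n hn]] P12] /nbhs_baireP[n' hn'] PQ]].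
have restr (u v : nat -> nat) i l : (i <= l)%N -> mkseq u l = mkseq v l -> mkseq u i = mkseq v i.
  by move=> il uv; rewrite -(take_mkseq u il) uv take_mkseq.
exists k, (maxn n n'); split=> // m nm z' x' b' Uz'; rewrite !size_mkseq => xx bb.
have lenm := leq_trans (leq_maxl _ _) nm; have len'm := leq_trans (leq_maxr _ _) nm.
apply: (PQ ((z', x'), b')); split=> /=; last by apply: hn'; exact: restr bb.
by apply: (P12 (z', x')); split=> /=; [exact: UP|apply: hn; exact: restr xx].
Qed.

(** A path through [child z x] yields some [b] no initial part of which is refuted by a basic
    neighbourhood of [z]; as [F] is closed, the limit belongs to it. *)
Let child_wf z (x : baire) : well_founded (child z x) <-> forall b, ~ F ((z, x), b).
Proof.
split=> [wf b Fb|nF].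
  apply: (@path_not_acc _ (child z x) (fun n => pickle (mkseq b n))); last exact: wf.
  move=> n; exists (mkseq b n), (b n); split; [by rewrite mkseqS|by []|rewrite size_mkseq -mkseqS].
  move=> k m _; rewrite size_mkseq => mn Uk; rewrite !take_mkseq // => /(_ z x b Uk).
  by rewrite !size_mkseq => /(_ erefl erefl).
move=> i; apply: contrapT => nacc; have [f f0 fP] := not_acc_path nacc.
have /choice[g gP] : forall n : nat, exists t : seq nat, f n = pickle t.
  by move=> n; have [t [a [_ ft _]]] := fP n; exists t.
have gS n : exists a, g n.+1 = rcons (g n) a.
  have [t [a [ft ft' _]]] := fP n; exists a; move: ft ft'; rewrite !gP.
  by move=> /(pcan_inj pickleK) -> /(pcan_inj pickleK) ->.
have [sz [h gE]] := rcons_path_limit 0%N gS.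
have [k [n [Uk av]]] := avoids_exists (nF h).
pose N := (k + n)%N; have [t [a [ft _]]] := fP N.
have tE : rcons t a = g N.+1 by move: ft; rewrite gP => /(pcan_inj pickleK).
rewrite tE; have szt : (size t).+1 = size (g N.+1) by rewrite -tE size_rcons.
have leN : (N <= size (g N.+1))%N by rewrite sz addnS ltnW // ltnS leq_addl.
move=> /(_ k n); rewrite szt (leq_trans _ leN) ?leq_addr // (leq_trans _ leN) ?leq_addl //.
move=> /(_ isT isT Uk); apply.
have len : (n <= size (g N.+1))%N by rewrite (leq_trans _ leN) // leq_addl.
have -> : take n (g N.+1) = mkseq h n by rewrite gE take_mkseq.
by rewrite take_mkseq //; exact: av.
Qed.

(** The halves of [u] approximate a point [x], and its parities a relation that has to contain
    [child z x] as far as [u] decides it. Inclusion suffices, since well-foundedness passes to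
    subrelations. *)
Let good (z : Z) (u : seq nat) : Prop := forall i j : nat, (pickle (i, j) < size u)%N ->
  (exists (t : seq nat) (a : nat), [/\ i = pickle (rcons t a), j = pickle t,
    ((size t).+1 <= size u)%N & in_tree z (take (size t).+1 (map half u)) (rcons t a)]) ->
  odd (nth 0%N u (pickle (i, j))).

Let g (z : Z) : baire := fun m =>
  if (unpickle m : option (seq nat)) is Some u then (~~ `[< good z u >] : nat) else 1%N.

Let tree_g z u : tree_of (g z) u <-> good z u.
Proof.
by rewrite /tree_of /g pickleK; case: asboolP => h; split.
Qed.

Let borel_g : borel_function g.
Proof.
have sB := @sigma_algebra_borel Z; apply: borel_function_baire => m v; rewrite /g.
case: (unpickle m : option (seq nat)) => [u|]; last exact: (sa_const sB).
have bg : borel_set [set z | good z u].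
  apply: (sa_forall sB) => i; apply: (sa_forall sB) => j.
  apply: (sa_imp sB); first exact: (sa_const sB).
  apply: (sa_imp sB); last exact: (sa_const sB).
  apply: (sa_exists sB) => t; apply: (sa_exists sB) => a.
  (* Only the open conditions [U k z] depend on [z]. *)
  apply: (@sa_ext Z (@borel_set Z) (fun z => (forall (k n : nat), (k <= size (rcons t a))%N ->
    (n <= size (rcons t a))%N -> U k z -> ~ avoids k (take n (take (size t).+1 (map half u))) (take n (rcons t a)))
     /\ [/\ i = pickle (rcons t a), j = pickle t & ((size t).+1 <= size u)%N])).
    by move=> z; split=> [[h [h1 h2 h3]]|[h1 h2 h3 h]].
  apply: (sa_and sB); last exact: (sa_const sB).
  do 2 (apply: (sa_forall sB) => ?); do 2 (apply: (sa_imp sB); first exact: (sa_const sB)).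
  by apply: (sa_imp sB); [apply: borel_open; exact: U_open|exact: (sa_const sB)].
apply: (@sa_ext Z (@borel_set Z) (fun z => (good z u /\ v = 0%N) \/ (~ good z u /\ v = 1%N))).
  move=> z; case: asboolP => h; split=> /=; first by case=> -[].
  - by move=> <-; left.
  - by case=> -[].
  - by move=> <-; right.
apply: (sa_or sB); apply: (sa_and sB); [exact: bg|exact: (sa_const sB)| |exact: (sa_const sB)].
exact: (@sa_not Z (@borel_set Z) sB (fun z => good z u)).
Qed.

Lemma hardness_reduction : exists2 f : Z -> baire, borel_function f &
  forall z, (exists x, forall b, ~ F ((z, x), b)) <-> branch_set (f z).
Proof.
exists g; first exact: borel_g.
move=> z; split=> [[x /child_wf wf]|[y yg wf]].
  pose bit (n : nat) : bool := `[< exists i j : nat, n = pickle (i, j) /\ child z x i j >].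
  pose y n : nat := (bit n + (x n).*2)%N.
  have yhalf n : map half (mkseq y n) = mkseq x n.
    by rewrite /mkseq -map_comp; apply: eq_map => k /=; rewrite half_bit_double.
  have yodd i j : odd (y (pickle (i, j))) <-> child z x i j.
    rewrite oddD odd_double addbF oddb; split=> [/asboolP[i' [j' [/(pcan_inj pickleK)[-> ->]]]]|h] //.
    by apply/asboolP; exists i, j.
  exists y; last first.
    by move=> i; elim: (wf i) => {}i _ ih; constructor=> j /yodd; exact: ih.
  move=> n; apply/tree_g => i j ijn [t [a [it jt tn h]]].
  rewrite size_mkseq in ijn tn; rewrite nth_mkseq //; apply/yodd; exists t, a; split=> //.
  by move: h; rewrite yhalf take_mkseq.
pose x : baire := fun n => half (y n).
exists x; apply/child_wf => i; elim: (wf i) => {}i _ ih; constructor=> j ji.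
apply: ih; have [t [a [jt it h]]] := ji.
(* The first [n.+1] entries of [y] contain the bit for the pair and the initial segment of [x] on
   which its status as a child depends. *)
pose n := (pickle (j, i) + (size t).+1)%N.
have /tree_g/(_ j i) := yg n.+1; rewrite size_mkseq nth_mkseq ?ltnS ?leq_addr //; apply=> //.
exists t, a; split=> //; first by rewrite leqW // leq_addl.
rewrite /mkseq -map_comp -/(mkseq x n.+1) take_mkseq //.
by rewrite leqW // leq_addl.
Qed.
End Hardness.

Lemma Sigma12_hard_branch_set (R : realType) : Sigma12_hard R branch_set.
Proof.
move=> Z /polish_base[U [U_open U_base]] A [C [F F_closed CF] ->].
have [f bf fP] := hardness_reduction U_open U_base F_closed.
exists f => // z; rewrite -fP; split=> [[[z' x] Czx <-]|[x nF]].
  by exists x => b Fb; suff : (~` C) (z', x) by []; rewrite CF; exists ((z', x), b).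
exists (z, x) => //; apply: contrapT => nC.
by have : (~` C) (z, x) by []; rewrite CF => -[[p b] Fb /= pE]; move: Fb; rewrite pE; exact: nF.
Qed.

(** * Definability of pseudo-ranks *)

Lemma sa_and3 (T : Type) (G : set (set T)) (P1 P2 P3 : T -> Prop) : sigma_algebra setT G ->
  G [set t | P1 t] -> G [set t | P2 t] -> G [set t | P3 t] ->
  G [set t | [/\ P1 t, P2 t & P3 t]].
Proof.
move=> sG h1 h2 h3; apply: (@sa_ext T G (fun t => P1 t /\ (P2 t /\ P3 t))).
  by move=> t; split=> [[? []]|[]].
by do ?[apply: (sa_and sG) => //].
Qed.

Lemma sa_and4 (T : Type) (G : set (set T)) (P1 P2 P3 P4 : T -> Prop) : sigma_algebra setT G ->
  G [set t | P1 t] -> G [set t | P2 t] -> G [set t | P3 t] -> G [set t | P4 t] ->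
  G [set t | [/\ P1 t, P2 t, P3 t & P4 t]].
Proof.
move=> sG h1 h2 h3 h4; apply: (@sa_ext T G (fun t => (P1 t /\ P2 t) /\ (P3 t /\ P4 t))).
  by move=> t; split=> [[[? ?] []]|[]].
by do ?[apply: (sa_and sG) => //].
Qed.

(** The bound [b] is fixed and well-founded while the order varies with [t]. Induction on [b]
    unfolds the comparison into countable quantifiers, so bounded ranks are measurable. *)
Lemma sa_rk_le (T : Type) (G : set (set T)) (A B : countType) (lt : T -> A -> A -> Prop)
    (rb : B -> B -> Prop) a b : sigma_algebra setT G ->
  (forall a a', G [set t | lt t a a']) -> Acc rb b ->
  G [set t | rk_le (lt t) rb a b].
Proof.
move=> sG Glt accb; elim: accb a => {}b _ ih a.
apply: (@sa_ext T G (fun t => forall a', lt t a' a -> exists2 b', rb b' b & rk_le (lt t) rb a' b')).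
  by move=> t; rewrite rk_leP.
apply: (sa_forall sG) => a'; apply: (sa_imp sG); first exact: Glt.
apply: (@sa_ext T G (fun t => exists b', rb b' b /\ rk_le (lt t) rb a' b')).
  by move=> t; split=> [[b' []]|[b']]; exists b'.
apply: (sa_exists sG) => b'; have [bb'|nbb'] := pselect (rb b' b).
  by apply: (sa_and sG); [exact: (sa_const sG)|exact: ih].
apply: (@sa_ext T G (fun _ => False)); first by move=> t; split=> [[]|[]].
exact: (sa_const sG).
Qed.

(* Nodes of the tree of attempts to find y with F (z, y), coded by natural numbers. *)
Definition section_tree (F : set (baire * baire)) (z : baire) (c u : nat) : Prop :=
  exists (s : seq nat) (n : nat), [/\ u = pickle s, c = pickle (rcons s n)
    & meets F (mkseq z (size s).+1) (rcons s n)].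

Definition order_of (w : baire) (u v : nat) : bool := slice 0 w (pickle (u, v)) != 0%N.

Definition derivative_of (w : baire) (d e : nat) (v : seq (nat * nat)) : bool :=
  slice 1 w (pickle (d, e, v)) != 0%N.

Definition witness F (s z w : baire) : Prop :=
  pseudo_rank (section_tree F z) (tree_of s) (order_of w) (derivative_of w).

Lemma Delta11_witness F :
  Delta11 [set p : (baire * baire) * baire | witness F p.1.1 p.1.2 p.2].
Proof.
pose T : topologicalType := ((baire * baire) * baire)%type.
have sG := @sigma_algebra_Delta11 T.
have c1 : continuous (fun p : T => p.1) by exact: continuous_fst.
have c2 : continuous (fun p : T => p.2) by exact: continuous_snd.
have c11 : continuous (fun p : T => p.1.1) := continuous_compose c1 (@continuous_fst _ _).
have c12 : continuous (fun p : T => p.1.2) := continuous_compose c1 (@continuous_snd _ _).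
have Gs u : Delta11 [set p : T | tree_of p.1.1 u].
  apply: (@Delta11_lconst T _ (fun p : T => p.1.1 (pickle u)) (fun m => m == 0%N)).
  exact: (lconst_baire _ c11).
have Gle u v : Delta11 [set p : T | order_of p.2 u v].
  apply: (@Delta11_lconst T _ (fun p : T => slice 0 p.2 (pickle (u, v))) (fun m => m != 0%N)).
  exact: (lconst_baire _ (continuous_compose c2 (@continuous_slice 0))).
have GD d e v : Delta11 [set p : T | derivative_of p.2 d e v].
  apply: (@Delta11_lconst T _ (fun p : T => slice 1 p.2 (pickle (d, e, v))) (fun m => m != 0%N)).
  exact: (lconst_baire _ (continuous_compose c2 (@continuous_slice 1))).
have GK c u : Delta11 [set p : T | section_tree F p.1.2 c u].
  apply: (sa_exists sG) => s; apply: (sa_exists sG) => n.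
  apply: (sa_and3 sG); [exact: (sa_const sG)|exact: (sa_const sG)|].
  apply: (@Delta11_lconst T _ (fun p : T => mkseq p.1.2 (size s).+1) (fun u => meets F u (rcons s n))).
  by apply: lconst_mkseq_fun => k; exact: (lconst_baire _ c12).
have GN u v : Delta11 [set p : T | ~~ order_of p.2 u v].
  apply: (@sa_ext T (@Delta11 T) (fun p => ~ order_of p.2 u v)); last exact: (sa_not sG).
  by move=> p; split=> /negP.
have GND d e v : Delta11 [set p : T | ~~ derivative_of p.2 d e v].
  apply: (@sa_ext T (@Delta11 T) (fun p => ~ derivative_of p.2 d e v)); last exact: (sa_not sG).
  by move=> p; split=> /negP.
have Gslt u v : Delta11 [set p : T | slt (order_of p.2) u v].
  apply: (@sa_ext T (@Delta11 T) (fun p => order_of p.2 u v /\ ~~ order_of p.2 v u)).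
    by move=> p; split=> /andP.
  exact: (sa_and sG).
have Gatt d v : Delta11 [set p : T | attempt_below (tree_of p.1.1) (order_of p.2) d v].
  apply: (sa_and3 sG).
  - by apply: (sa_forall sG) => k; apply: (sa_imp sG); [exact: (sa_const sG)|].
  - by apply: (sa_forall sG) => k; apply: (sa_imp sG); [exact: (sa_const sG)|].
  - apply: (sa_forall sG) => i; apply: (sa_forall sG) => j.
    by do 4 (apply: (sa_imp sG); first exact: (sa_const sG)).
apply: (sa_and4 sG).
- apply: (sa_and3 sG).
  + apply: (sa_forall sG) => u; apply: (sa_forall sG) => v; apply: (sa_imp sG) => //.
    apply: (@sa_ext T (@Delta11 T) (fun p => order_of p.2 u u /\ order_of p.2 v v)).
      by move=> p; split=> /andP.
    exact: (sa_and sG).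
  + by do 3 (apply: (sa_forall sG) => ?); do 2 (apply: (sa_imp sG) => //).
  + apply: (sa_forall sG) => u; apply: (sa_forall sG) => v; do 2 (apply: (sa_imp sG) => //).
    apply: (@sa_ext T (@Delta11 T) (fun p => order_of p.2 u v \/ order_of p.2 v u)).
      by move=> p; split=> /orP.
    exact: (sa_or sG).
- apply: (sa_and3 sG).
  + by do 2 (apply: (sa_forall sG) => ?); do 2 (apply: (sa_imp sG) => //).
  + do 2 (apply: (sa_forall sG) => ?); apply: (sa_imp sG) => //.
    by apply: (sa_exists2 sG) => ?.
  + apply: (sa_forall sG) => ?; apply: (sa_imp sG) => //.
    by apply: (sa_exists2 sG) => ?.
- do 3 (apply: (sa_forall sG) => ?); do 2 (apply: (sa_imp sG) => //).
  apply: (sa_iff sG) => //; apply: (sa_forall sG) => ?; apply: (sa_imp sG) => //.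
  by apply: (sa_exists2 sG) => ?.
- do 2 (apply: (sa_forall sG) => ?); do 3 (apply: (sa_imp sG) => //).
  apply: (sa_exists sG) => ?; apply: (sa_and3 sG) => //.
  by apply: (sa_forall sG) => ?; apply: (sa_imp sG).
Qed.

(** The condition [witness] is Delta11. Storing in [w] also a point of a closed set that projects
    onto it makes the condition on [w] closed. *)
Lemma closed_witness F : exists V : set ((baire * baire) * baire), [/\ closed V,
  forall s z w, V ((s, z), w) -> witness F s z (slice 0 w)
  & forall s z, ~ branch_set s -> exists w, V ((s, z), w)].
Proof.
have [/Sigma11P[C cC CP] _] := Delta11_witness F.
exists ((fun p : (baire * baire) * baire => ((p.1, slice 0 p.2), slice 1 p.2)) @^-1` C); split.
- apply: closed_preimage => //; apply: continuous_pair; first apply: continuous_pair.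
  + exact: continuous_fst.
  + apply: continuous_compose; [exact: continuous_snd|exact: continuous_slice].
  + apply: continuous_compose; [exact: continuous_snd|exact: continuous_slice].
- by move=> s z w /= Cw; apply/(CP ((s, z), slice 0 w)); exists (slice 1 w).
- move=> s z ns; have [le [D h]] := pseudo_rank_exists (section_tree F z) ns.
  pose w := join (fun m => if (unpickle m : option (nat * nat)) is Some (u, v)
      then le u v : nat else 0%N)
    (fun m => if (unpickle m : option (nat * nat * seq (nat * nat))) is Some (d, e, v)
      then D d e v : nat else 0%N).
  have wit : witness F s z w.
    rewrite /witness.
    have -> : order_of w = le.
      by apply/funext => u; apply/funext => v; rewrite /order_of slice0_join pickleK; case: (le u v).
    have -> : derivative_of w = D.
      apply/funext => d; apply/funext => e; apply/funext => v.
      by rewrite /derivative_of slice1_join pickleK; case: (D d e v).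
    exact: h.
  have /(CP ((s, z), w))[b Cb] := wit.
  by exists (join w b); rewrite /= slice0_join slice1_join.
Qed.

(** * Borel selection of branches *)

(** The path takes the least admissible extension at each step, so each finite stage depends on [t]
    in a Borel way; 0 is the default where nothing extends. *)
Lemma borel_path (T : topologicalType) (I : T -> seq nat -> Prop) :
  (forall u, borel_set [set t | I t u]) ->
  exists2 c : T -> baire, borel_function c & forall t, I t [::] ->
    (forall u, I t u -> exists k, I t (rcons u k)) -> forall n, I t (mkseq (c t) n).
Proof.
move=> bI; have sB := @sigma_algebra_borel T.
pose next t u : nat := if pselect (exists k, `[< I t (rcons u k) >]) is left h
  then ex_minn h else 0%N.
have bnext u k : borel_set [set t | next t u = k].
  apply: (@sa_ext T (@borel_set T) (fun t => (I t (rcons u k) /\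
      forall j : nat, (j < k)%N -> ~ I t (rcons u j)) \/ (k = 0%N /\ forall j : nat, ~ I t (rcons u j)))).
    move=> t; rewrite /next; case: pselect => h.
      case: ex_minnP => m /asboolP Im minm; split=> [[[Ik mink]|[_ /(_ m)]]|<-] //.
        apply/eqP; rewrite eqn_leq; apply/andP; split; first by apply: minm; exact/asboolP.
        by rewrite leqNgt; apply/negP => /mink.
      by left; split=> // j jm Ij; move: jm; rewrite ltnNge minm //; apply/asboolP.
    split=> [[[Ik _]|[]]|<-] //; first by case: h; exists k; apply/asboolP.
    by right; split=> // j Ij; apply: h; exists j; apply/asboolP.
  apply: (sa_or sB); apply: (sa_and sB) => //; last first.
  - by apply: (sa_forall sB) => j; apply: (sa_not sB).
  - exact: (sa_const sB).
  apply: (sa_forall sB) => j; apply: (sa_imp sB); [exact: (sa_const sB)|exact: (sa_not sB)].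
pose path t := fix path n := if n is n'.+1 then rcons (path n') (next t (path n')) else [::].
have bpath n : forall u, borel_set [set t | path t n = u].
  elim: n => [|n ih] u; first exact: (@sa_const T (@borel_set T) sB ([::] = u)).
  apply: (@sa_ext T (@borel_set T) (fun t => exists (v : seq nat) (k : nat),
      u = rcons v k /\ (path t n = v /\ next t v = k))).
    by move=> t; split=> [[v [k [-> [<- <-]]]]|<-] //; exists (path t n), (next t (path t n)).
  apply: (sa_exists sB) => v; apply: (sa_exists sB) => k.
  by apply: (sa_and sB); [exact: (sa_const sB)|exact: (sa_and sB)].
exists (fun t n => next t (path t n)).
  apply: borel_function_baire => n m.
  apply: (@sa_ext T (@borel_set T) (fun t => exists v : seq nat, path t n = v /\ next t v = m)).
    by move=> t; split=> [[v [-> ->]]|<-] //; exists (path t n).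
  by apply: (sa_exists sB) => v; exact: (sa_and sB).
move=> t I0 IS n; suff -> : mkseq (fun n => next t (path t n)) n = path t n.
  elim: n => // n ih /=; rewrite /next; case: pselect => h.
    by case: ex_minnP => m /asboolP.
  by case: h; have [k Ik] := IS _ ih; exists k; apply/asboolP.
by elim: n => // n ih; rewrite mkseqS ih.
Qed.

(** The path stays among the nodes that look ill-founded to the pseudo-rank. They form a Borel set
    because the bounds of [wf_part_bounded] come from [s] and [x] alone and thus serve all [t]. *)
Lemma borel_branch (F : set (baire * baire)) (T : topologicalType) (s : baire) (z w : T -> baire) :
  closed F -> branch_set s -> continuous z -> continuous w ->
  exists2 c : T -> baire, borel_function c & forall t, witness F s (z t) (w t) ->
    (exists y, F (z t, y)) -> F (z t, c t).
Proof.
move=> cF [x xs wf] cz cw; have sB := @sigma_algebra_borel T.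
pose R := rel_of x; pose J := extends (attempt (tree_of s) (rk_lt R R) (fun _ => True)).
(* Ranks are compared with accessible bounds only, as [sa_rk_le] requires. For a witness, [short]
   means accessible on the domain of the order. *)
pose short t u := (exists i, rk_le (slt (order_of (w t))) R u i) \/
  (exists v, Acc J v /\ rk_le (slt (order_of (w t))) J u v).
have ble u v : borel_set [set t | order_of (w t) u v].
  apply: (@borel_lconst T _ (fun t => slice 0 (w t) (pickle (u, v))) (fun m => m != 0%N)).
  exact: (lconst_baire _ (continuous_compose cw (@continuous_slice 0))).
have bnle u v : borel_set [set t | ~~ order_of (w t) u v].
  apply: (@sa_ext T (@borel_set T) (fun t => ~ order_of (w t) u v)); last exact: (sa_not sB).
  by move=> t; split=> /negP.
have bslt u v : borel_set [set t | slt (order_of (w t)) u v].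
  apply: (@sa_ext T (@borel_set T) (fun t => order_of (w t) u v /\ ~~ order_of (w t) v u)).
    by move=> t; split=> /andP.
  exact: (sa_and sB).
have bshort u : borel_set [set t | short t u].
  apply: (sa_or sB); first by apply: (sa_exists sB) => i; exact: (sa_rk_le _ sB bslt (wf i)).
  apply: (sa_exists sB) => v; have [accv|naccv] := pselect (Acc J v).
    by apply: (sa_and sB); [exact: (sa_const sB)|exact: (sa_rk_le _ sB bslt accv)].
  apply: (@sa_ext T (@borel_set T) (fun _ => False)); last exact: (sa_const sB).
  by move=> t; split=> [[]|[]].
pose I t (u : seq nat) := meets F (mkseq (z t) (size u)) u /\
  (~~ order_of (w t) (pickle u) (pickle u) \/ ~ short t (pickle u)).
have [|c bc cP] := @borel_path T I.
  move=> u; apply: (sa_and sB).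
    apply: (@borel_lconst T _ (fun t => mkseq (z t) (size u)) (fun v => meets F v u)).
    by apply: lconst_mkseq_fun => k; exact: (lconst_baire _ cz).
  by apply: (sa_or sB) => //; exact: (sa_not sB).
exists c => // t wt [y Fy]; have [pre ex _ _] := wt.
have shortP u : order_of (w t) u u -> short t u <-> Acc (slt (order_of (w t))) u.
  move=> lu; split=> [[[i]|[v [accv]]]|acc].
  - exact: rk_le_Acc (wf i).
  - exact: rk_le_Acc accv.
  - have [[i h]|[v accv h]] := wf_part_bounded xs wf wt lu acc; first by left; exists i.
    by right; exists v.
have goodP u : (~~ order_of (w t) u u \/ ~ short t u) <->
    (~~ order_of (w t) u u \/ ~ Acc (slt (order_of (w t))) u).
  have [lu|nlu] := boolP (order_of (w t) u u); last by split=> _; left.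
  by split=> -[//|h]; right => /(shortP _ lu).
apply/meets_closed => // n; suff [] : I t (mkseq (c t) n) by rewrite size_mkseq.
apply: cP.
- split; first by have /(meets_closed _ _ cF)/(_ 0%N) := Fy.
  apply/goodP; apply: (exact_root pre ex).
  apply: (@path_not_acc _ _ (fun n => pickle (mkseq y n))) => k.
  exists (mkseq y k), (y k); split; [by []|by rewrite mkseqS|].
  by rewrite size_mkseq -mkseqS; exact: ((meets_closed (z t) y cF).1 Fy k.+1).
- move=> u [_ /goodP gu]; have [_ [v [k [/(pcan_inj pickleK) uv -> mk]]] gc] := exact_step pre ex gu.
  exists k; rewrite uv; split; [by rewrite size_rcons|exact/goodP].
Qed.

(** * The reduction *)

Lemma Sigma11_and (T : topologicalType) (A B : set T) :
  Sigma11 A -> Sigma11 B -> Sigma11 [set t | A t /\ B t].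
Proof.
move=> hA hB; apply: (@Sigma11_ext _ [set t | forall n, (if n is 0%N then A else B) t]).
  by move=> t; split=> [h|[h1 h2] [|n]] //; split; [exact: (h 0%N)|exact: (h 1%N)].
by apply: (@Sigma11_forall _ (fun n => if n is 0%N then A else B)) => -[].
Qed.

Lemma Sigma11_or (T : topologicalType) (A B : set T) :
  Sigma11 A -> Sigma11 B -> Sigma11 [set t | A t \/ B t].
Proof.
move=> hA hB; apply: (@Sigma11_ext _ [set t | exists n, (if n is 0%N then A else B) t]).
  move=> t; split=> [[[|n]]|[h|h]]; [by left|by right|by exists 0%N|by exists 1%N].
by apply: (@Sigma11_exists _ (fun n => if n is 0%N then A else B)) => -[].
Qed.

Lemma Sigma11_code_ill (T : topologicalType) (q : T -> baire) :
  continuous q -> Sigma11 [set t | code_ill (q t)].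
Proof.
move=> cq; apply: (@Sigma11_ext _ [set t | exists n, exists b : baire,
    if (unpickle n : option (seq nat)) is Some u then
      forall m, q t (pickle (u ++ mkseq b m)) = 0%N else False]).
  move=> t; split=> [[n [b]]|[u [b h]]].
    by case: unpickle => // u h; exists u, b.
  by exists (pickle u), b; rewrite pickleK.
apply: Sigma11_exists => n; apply: (@Sigma11_project _ [set p : T * baire |
    if (unpickle n : option (seq nat)) is Some u then
      forall m, q p.1 (pickle (u ++ mkseq p.2 m)) = 0%N else False]).
case: (unpickle n : option (seq nat)) => [u|]; last exact/Sigma11_closed/closed0.
apply: Sigma11_forall => m; apply: Sigma11_closed.
apply: (@lconst_closed _ _ (fun p : T * baire => q p.1 (pickle (u ++ mkseq p.2 m))) (fun k => k = 0%N)).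
apply: (lconst_app (x := fun p : T * baire => q p.1)) => [k|].
  exact: (lconst_baire _ (continuous_compose (@continuous_fst _ _) cq)).
apply: (@lconst_comp _ _ _ (fun p : T * baire => mkseq p.2 m) (fun v => pickle (u ++ v))).
apply: (lconst_mkseq_fun (f := fun p : T * baire => p.2)) => k.
exact: (lconst_baire _ (@continuous_snd _ _)).
Qed.

Definition eval_of (x : baire) (u : seq nat) : bool := x (pickle u) != 0%N.

Lemma Delta11_code_eval (T : topologicalType) (q t e : T -> baire) :
  continuous q -> continuous t -> continuous e ->
  Delta11 [set p | code_eval (q p) (t p) (eval_of (e p))].
Proof.
move=> cq ct ce; have sG := @sigma_algebra_Delta11 T.
have Gq u k : Delta11 [set p | q p (pickle u) = k].
  exact: (@Delta11_lconst T _ (fun p => q p (pickle u)) (fun m => m = k) (lconst_baire _ cq)).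
have Ge u (b : bool) : Delta11 [set p | eval_of (e p) u = b].
  exact: (@Delta11_lconst T _ (fun p => e p (pickle u)) (fun m => (m != 0%N) = b) (lconst_baire _ ce)).
have Gne u : Delta11 [set p | ~~ eval_of (e p) u].
  exact: (@Delta11_lconst T _ (fun p => e p (pickle u)) (fun m => ~~ (m != 0%N)) (lconst_baire _ ce)).
have Gl k (b : bool) : Delta11 [set p | leaf k (t p) = b].
  rewrite /leaf; case: (unpickle k : option (nat * nat)) => [[i m]|]; last exact: (sa_const sG).
  exact: (@Delta11_lconst T _ (fun p => t p i) (fun n => (n == m) = b) (lconst_baire _ ct)).
apply: (@sa_ext T (@Delta11 T) (fun p => forall (u : seq nat),
   (q p (pickle u) = 0%N -> (eval_of (e p) u <-> forall n : nat, ~~ eval_of (e p) (rcons u n))) /\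
   forall k : nat, q p (pickle u) = k.+1 ->
     exists b : bool, eval_of (e p) u = b /\ leaf k (t p) = b)).
  move=> p; split=> h u; have := h u; case: (q p (pickle u)) => [|k].
  - by move=> [+ _]; exact.
  - by move=> [_ /(_ k erefl)[b [-> ->]]].
  - by move=> hu; split.
  - by move=> hu; split=> // _ [<-]; exists (eval_of (e p) u).
apply: (sa_forall sG) => u; apply: (sa_and sG).
  apply: (sa_imp sG) => //; apply: (sa_iff sG); first exact: Ge.
  by apply: (sa_forall sG) => n.
apply: (sa_forall sG) => k; apply: (sa_imp sG) => //.
by apply: (sa_exists sG) => b; exact: (sa_and sG).
Qed.

Lemma Delta11_code_output (T : topologicalType) (e v : T -> baire) :
  continuous e -> continuous v ->
  Delta11 [set p | code_output (eval_of (e p)) (v p)].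
Proof.
move=> ce cv; have sG := @sigma_algebra_Delta11 T.
have Gv n k : Delta11 [set p | v p n = k].
  exact: (@Delta11_lconst T _ (fun p => v p n) (fun m => m = k) (lconst_baire _ cv)).
have Ge u : Delta11 [set p | eval_of (e p) u].
  exact: (@Delta11_lconst T _ (fun p => e p (pickle u)) (fun m => m != 0%N) (lconst_baire _ ce)).
have Gne u : Delta11 [set p | ~~ eval_of (e p) u].
  exact: (@Delta11_lconst T _ (fun p => e p (pickle u)) (fun m => ~~ (m != 0%N)) (lconst_baire _ ce)).
apply: (sa_forall sG) => n; apply: (sa_or sG).
  apply: (@sa_ext T (@Delta11 T) (fun p => exists k : nat, v p n = k /\
      (eval_of (e p) [:: pickle (n, k)] /\
       forall m : nat, (m < k)%N -> ~~ eval_of (e p) [:: pickle (n, m)]))).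
    by move=> p; split=> [[k [->]]|h] //; exists (v p n).
  apply: (sa_exists sG) => k; apply: (sa_and sG) => //; apply: (sa_and sG) => //.
  by apply: (sa_forall sG) => m; apply: (sa_imp sG) => //; exact: (sa_const sG).
by apply: (sa_and sG) => //; apply: (sa_forall sG) => m.
Qed.

Lemma xsectionP (T U : Type) (A : set (T * U)) x y : xsection A x y <-> A (x, y).
Proof. by rewrite /xsection /= in_setE. Qed.

Theorem theorem1p6 (R : realType) (X Y : topologicalType)
    (Gamma : set_class) (Phi : set X -> set Y)
    (X_polish : polish R X) (Y_polish : polish R Y)
    (X_uncountable : ~ countable [set: X])
    (Y_uncountable : ~ countable [set: Y])
    (Gamma_preimage : closed_under_continuous_preimages R Gamma)
    (Gamma_union : closed_under_unions R Gamma)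
    (Gamma_intersection : closed_under_intersections R Gamma)
    (Gamma_basic : contains_closed_and_open R Gamma)
    (Phi_Pi11 : maps_to_Pi11 Gamma Phi)
    (Phi_Pi11_on : Pi11_on R Gamma Phi)
    (Phi_hard : nicely_Sigma11_hard_on Gamma Phi) :
  Sigma12_hard_on R Gamma (uniform_family Gamma Phi).
Proof.
have baire_polish := polish_baire R.
(* An empty [Y] would be countable; a point is required to code [Y] by the Baire space. *)
have [y0 _] : exists y0 : Y, True.
  apply: contrapT => nY; apply: Y_uncountable.
  have -> : [set: Y] = set0 by apply/seteqP; split=> // y _; apply: nY; exists y.
  exact: countable0.
have [pi [sigma [c_pi b_sigma pi_sigma]]] := polish_coding y0 Y_polish.
have [B0 [D [GB0 SD DB0 hB0]]] := Phi_hard _ Sigma11_universal_set.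
have [FD cFD FDP] := (Sigma11P D).1 SD.
(* The second point consists of a name under [pi] of an element [y] and a witness that [D] contains
   the pair with [y]. *)
pose F : set (baire * baire) :=
  (fun p => ((p.1, pi (slice 0 p.2)), slice 1 p.2)) @^-1` FD.
have cF : closed F.
  apply: closed_preimage => //; apply: continuous_pair; first apply: continuous_pair.
  - exact: continuous_fst.
  - apply: continuous_compose c_pi; apply: continuous_compose; [exact: continuous_snd|exact: continuous_slice].
  - apply: continuous_compose; [exact: continuous_snd|exact: continuous_slice].
have FD_Phi z c : F (z, c) -> Phi (xsection B0 z) (pi (slice 0 c)).
  by move=> Fzc; apply: (DB0 (z, pi (slice 0 c))); apply/FDP; exists (slice 1 c).
have univ_F z : universal_set z -> exists c, F (z, c).
  move=> /(hB0 z).1[y /xsectionP/FDP[b FDb]]; exists (join (sigma y) b).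
  by rewrite /F /= slice0_join slice1_join pi_sigma.
have Phi_univ z y : Phi (xsection B0 z) y -> universal_set z.
  by move=> h; apply/(hB0 z).1/(hB0 z).2; exists y.
have [V [cV Vwit Vex]] := closed_witness F.
have SW : Sigma11 (~` bar Phi B0) by exact: Phi_Pi11_on.
(* The point a codes (e, (s, q)), and z is the code (e, a) of the assertion
   "a belongs to the analytic set with code e". *)
pose s_of (a : baire) := slice 0 (slice 1 a).
pose q_of (a : baire) := slice 1 (slice 1 a).
pose z_of (a : baire) := join (slice 0 a) a.
(* The slices of [x] are a witness [w'], an evaluation of the code at the parameter formed with
   [w'], and the resulting name of an element of [Y]. *)
pose diag : set baire := [set a | code_ill (q_of a) \/ exists x : baire,
  V ((s_of a, z_of a), slice 0 x) /\
  (code_eval (q_of a) (join (q_of a) (slice 0 x)) (eval_of (slice 1 x)) /\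
  (code_output (eval_of (slice 1 x)) (slice 2 x) /\
   ~ bar Phi B0 (z_of a, pi (slice 2 x))))].
have Sdiag : Sigma11 diag.
  have csl k := @continuous_slice k.
  have c_s : continuous s_of by exact: continuous_compose.
  have c_q : continuous q_of by exact: continuous_compose.
  have c_z : continuous z_of by apply: continuous_join; [exact: csl|move=> x; exact: cvg_id].
  have c1 : continuous (fun p : baire * baire => p.1) by exact: continuous_fst.
  have c2 k : continuous (fun p : baire * baire => slice k p.2).
    by apply: continuous_compose; [exact: continuous_snd|exact: csl].
  apply: Sigma11_or; first exact: Sigma11_code_ill.
  apply: (@Sigma11_project _ [set p : baire * baire |
    V ((s_of p.1, z_of p.1), slice 0 p.2) /\
    (code_eval (q_of p.1) (join (q_of p.1) (slice 0 p.2)) (eval_of (slice 1 p.2)) /\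
    (code_output (eval_of (slice 1 p.2)) (slice 2 p.2) /\
    ~ bar Phi B0 (z_of p.1, pi (slice 2 p.2))))]).
  have c1s := continuous_compose c1 c_s; have c1q := continuous_compose c1 c_q.
  have c1z := continuous_compose c1 c_z.
  apply: Sigma11_and; [|apply: Sigma11_and; [|apply: Sigma11_and]].
  - apply/Sigma11_closed/(closed_preimage _ cV).
    by apply: continuous_pair => //; exact: continuous_pair.
  - by apply: (Delta11_code_eval _ _ _).1 => //; exact: continuous_join.
  - by apply: (Delta11_code_output _ _).1.
  - apply: (Sigma11_preimage _ SW); apply: continuous_pair => //.
    exact: continuous_compose c_pi.
(* Self-reference: [a] is given the code [e] of [diag] itself, so that [z_of a] becomes [r s q] and
   lies in the universal set iff [diag] holds at [a]. *)
have [e eP] := universalP Sdiag.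
pose r (s q : baire) : baire := join e (join e (join s q)).
have rP s q : universal_set (r s q) <-> diag (join e (join s q)).
  by rewrite eP /universal_set /= slice0_join slice1_join.
have diagE s q : diag (join e (join s q)) <-> code_ill q \/ exists x : baire,
    V ((s, r s q), slice 0 x) /\
    (code_eval q (join q (slice 0 x)) (eval_of (slice 1 x)) /\
    (code_output (eval_of (slice 1 x)) (slice 2 x) /\
     ~ bar Phi B0 (r s q, pi (slice 2 x)))).
  by rewrite /diag /= /s_of /q_of /z_of !(slice0_join, slice1_join).
(* A code of the whole space provides the point [z0] to which invalid parameters are sent; [y1] is
   the value selected there. *)
have [cT cTP] : exists cT, forall x, universal cT x.
  have [cT h] := universalP (Sigma11_closed closedT); exists cT => x; exact/h.
pose z0 := join cT cT.
have z0P : universal_set z0 by rewrite /universal_set /= slice0_join.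
have [y1 y1P] : exists y, Phi (xsection B0 z0) y.
  by have [c /FD_Phi h] := univ_F _ z0P; exists (pi (slice 0 c)).
pose valid (s t : baire) : Prop := V ((s, r s (slice 0 t)), slice 1 t).
pose zt (s t : baire) : baire := if pselect (valid s t) then r s (slice 0 t) else z0.
pose B : set (baire * (baire * X)) := [set p | B0 (zt p.1 p.2.1, p.2.2)].
have BE s t : xsection (xsection B s) t = xsection B0 (zt s t).
  by apply/seteqP; split=> x /xsectionP h; apply/xsectionP; [move/xsectionP: h|apply/xsectionP].
(* If r s q were not in the universal set, every y would be outside of the
   section of [bar Phi B0] at r s q, and the diagonal condition would hold. *)
have valid_univ s t : valid s t -> universal_set (r s (slice 0 t)).
  move=> val; apply: contrapT => nU; apply: (nU); apply/rP/diagE.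
  have [ill|nill] := pselect (code_ill (slice 0 t)); first by left.
  have wf : code_wf (slice 0 t) by apply: contrapT => /code_illP.
  right; have [ev evP] := code_eval_exists (join (slice 0 t) (slice 1 t)) wf.
  have [v vP] := code_output_exists ev.
  pose eb : baire := fun m => if (unpickle m : option (seq nat)) is Some u then ev u : nat else 0%N.
  have ebE : eval_of eb = ev.
    by apply/funext => u; rewrite /eval_of /eb pickleK; case: (ev u).
  exists (glue (fun k => if k is k'.+1 then if k' is 0%N then eb else v else slice 1 t)).
  rewrite !slice_glue ebE; split=> //; split=> //; split=> //.
  by move=> h; apply: nU; exact: Phi_univ h.
have c_r (S : topologicalType) (f g : S -> baire) : continuous f -> continuous g ->
    continuous (fun p => r (f p) (g p)).
  have ce : continuous (fun _ : S => e) by move=> x; exact: cvg_cst.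
  by move=> cf cg; do 3 (apply: continuous_join => //).
have in_family s : branch_set s -> full_borel_uniformization (bar Phi (xsection B s)).
  move=> sS.
  have cs : continuous (fun _ : baire => s) by move=> x; exact: cvg_cst.
  have cz := c_r _ _ _ cs (@continuous_slice 0).
  have cw := continuous_compose (@continuous_slice 1) (@continuous_slice 0).
  have [c bc cP] := borel_branch cF sS cz cw.
  exists (fun t => if pselect (valid s t) then pi (slice 0 (c t)) else y1).
    apply: borel_if.
    - have cvalid : closed [set t | valid s t].
        apply: (closed_preimage _ cV); apply: continuous_pair; last exact: continuous_slice.
        exact: continuous_pair.
      exact: borel_closed.
    - have c0 : continuous (fun x : baire => pi (slice 0 x)).
        exact: (continuous_compose (@continuous_slice 0) c_pi).
      exact: (borel_comp bc (borel_continuous c0)).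
    - by apply: borel_continuous => x; exact: cvg_cst.
  move=> t; rewrite /bar /section_graph /= BE /zt; case: pselect => val //=.
  by apply: FD_Phi; apply: cP; [exact: Vwit val|exact/univ_F/valid_univ].
have not_in_family s : ~ branch_set s -> ~ full_borel_uniformization (bar Phi (xsection B s)).
  move=> sS [f bf fP].
  (* The code is one of [f] followed by [sigma]; applying [pi] to its output recovers [f]. *)
  have [q [wf qP]] := borel_function_coded (borel_comp bf b_sigma).
  have fq w : V ((s, r s q), w) -> bar Phi B0 (r s q, f (join q w)).
    move=> Vw; have := fP (join q w); rewrite /bar /section_graph /= BE /zt /valid.
    by rewrite slice0_join slice1_join; case: pselect.
  (* A witness exists for the very point [r s q], so [f] has a value there and [diag] holds. Its
     witness [x] then says that [f] misses the section at a valid parameter, against [fq]. *)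
  have [w Vw] := Vex s (r s q) sS.
  have /rP/diagE[/code_illP|[x [Vx [ev [out]]]]] := Phi_univ _ _ (fq w Vw); first by apply.
  by apply; rewrite (qP _ _ _ ev out) pi_sigma; exact: fq.
have BX_polish := polish_prod baire_polish X_polish.
have BBX_polish := polish_prod baire_polish BX_polish.
have GB : Gamma (baire * (baire * X))%type B.
  pose C : set (baire * (baire * X)) := [set p | valid p.1 p.2.1].
  have c1 : continuous (fun p : baire * (baire * X) => p.1) by exact: continuous_fst.
  have c2 : continuous (fun p : baire * (baire * X) => p.2) by exact: continuous_snd.
  have c21 : continuous (fun p : baire * (baire * X) => p.2.1).
    by apply: continuous_compose c2 _; exact: continuous_fst.
  have c22 : continuous (fun p : baire * (baire * X) => p.2.2).
    by apply: continuous_compose c2 _; exact: continuous_snd.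
  have c21s k : continuous (fun p : baire * (baire * X) => slice k p.2.1).
    by apply: continuous_compose c21 _; exact: continuous_slice.
  have crp := c_r _ _ _ c1 (c21s 0%N).
  have cC : closed C.
    by apply: (closed_preimage _ cV); do 2 (apply: continuous_pair => //).
  (* The map [zt] is continuous on the closed set [C] and on its open complement separately. *)
  have -> : B = (C `&` (fun p => (r p.1 (slice 0 p.2.1), p.2.2)) @^-1` B0) `|`
      (~` C `&` (fun p => (z0, p.2.2)) @^-1` B0).
    apply/seteqP; split=> p; rewrite /B /C /zt /=; case: pselect => val //=.
    - by left.
    - by right.
    - by case=> [[]|[]].
    - by case=> [[]|[]].
  apply: Gamma_union => //; apply: Gamma_intersection => //.
  - by apply: Gamma_basic => //; left.
  - apply: (Gamma_preimage _ _ BBX_polish BX_polish (fun p => (r p.1 (slice 0 p.2.1), p.2.2)) B0) => //.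
    exact: continuous_pair.
  - by apply: Gamma_basic => //; right; exact: closed_openC.
  - apply: (Gamma_preimage _ _ BBX_polish BX_polish (fun p => (z0, p.2.2)) B0) => //.
    by apply: continuous_pair => // x; exact: cvg_cst.
exists B => //.
(* The sections of [B] belong to the uniform family exactly for [s] in [branch_set], so hardness
   carries over unchanged. *)
have -> : [set s | uniform_family Gamma Phi (xsection B s)] = branch_set.
  apply/seteqP; split=> s.
    by move=> [_ h]; apply: contrapT => /not_in_family.
  move=> sS; split; last exact: in_family.
  have -> : xsection B s = (fun p => (s, p)) @^-1` B by apply/seteqP; split=> p /xsectionP.
  apply: (Gamma_preimage _ _ BX_polish BBX_polish (fun p => (s, p)) B) => //.
  by apply: continuous_pair => x; [exact: cvg_cst|exact: cvg_id].
exact: Sigma12_hard_branch_set.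
Qed.
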